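(* Let $A\in\mathbb{C}^{m\times n}$ and $B\in\mathbb{C}^{m}_{\mathrm H}$. Let $\mathcal{S}$ be the set of all $X\in\mathbb{C}^{n}_{\mathrm H}$ minimizing $\|B-AXA^*\|_F$ over $\mathbb{C}^{n}_{\mathrm H}$ (least-squares Hermitian solutions), and let $\mathcal{T}$ be the set of all $Y\in\mathbb{C}^{n}_{\mathrm H}$ minimizing $r(B-AYA^* )$ over $\mathbb{C}^{n}_{\mathrm H}$ (least-rank Hermitian solutions). Put $$M=\begin{bmatrix} B & A \\ A^* & 0 \end{bmatrix},\qquad N=\begin{bmatrix} B & BA & A \\ A^*B & 0 & 0 \\ A^* & 0 & 0 \end{bmatrix}.$$ Then $$\max_{X\in\mathcal{S},\,Y\in\mathcal{T}}r(X-Y)=\min\{n,\ 2n+r(N)-2r(A)-r(M)\},$$ $$\min_{X\in\mathcal{S},\,Y\in\mathcal{T}}r(X-Y)=r(N)+r(M)-2r[\,A,\,B\,]-2r(A),$$ $$\max_{X\in\mathcal{S},\,Y\in\mathcal{T}}i_{\pm}(X-Y)=i_{\mp}(N)+n-r(A)-i_{\mp}(M),$$ $$\min_{X\in\mathcal{S},\,Y\in\mathcal{T}}i_{\pm}(X-Y)=i_{\mp}(N)+i_{\pm}(M)-r[\,A,\,B\,]-r(A).$$ Under the condition $B\succcurlyeq0$, $$\max_{X\in\mathcal{S},\,Y\in\mathcal{T}}r(X-Y)=\min\{n,\ 2n+r[\,A,\,BA\,]-3r(A)\},\qquad \min_{X\in\mathcal{S},\,Y\in\mathcal{T}}r(X-Y)=r[\,A,\,BA\,]-r(A),$$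 $$\max_{X\in\mathcal{S},\,Y\in\mathcal{T}}i_+(X-Y)=r[\,A,\,BA\,]+n-2r(A),\qquad \max_{X\in\mathcal{S},\,Y\in\mathcal{T}}i_-(X-Y)=n-r(A),$$ $$\min_{X\in\mathcal{S},\,Y\in\mathcal{T}}i_+(X-Y)=r[\,A,\,BA\,]-r(A),\qquad \min_{X\in\mathcal{S},\,Y\in\mathcal{T}}i_-(X-Y)=0.$$ In consequence: (a) There exist $X\in\mathcal{S}$ and $Y\in\mathcal{T}$ such that $X-Y$ is nonsingular if and only if $r(N)\geqslant 2r(A)+r(M)-n$. (b) $X-Y$ is nonsingular for all $X\in\mathcal{S}$ and $Y\in\mathcal{T}$ if and only if $r(N)+r(M)=2r[\,A,\,B\,]+2r(A)+n$. (c) There exist $X\in\mathcal{S}$ and $Y\in\mathcal{T}$ such that $X=Y$ if and only if $r(N)+r(M)=2r[\,A,\,B\,]+2r(A)$. (d) There exist $X\in\mathcal{S}$ and $Y\in\mathcal{T}$ such that $X\succ Y$ if and only if $i_-(N)=i_-(M)+r(A)$. (e) $X\succ Y$ for all $X\in\mathcal{S}$ and $Y\in\mathcal{T}$ if and only if $i_-(N)=r(A)+r[\,A,\,B\,]-i_+(M)+n$. (f) There exist $X\in\mathcal{S}$ and $Y\in\mathcal{T}$ such that $X\succcurlyeq Y$ if and only if $i_+(N)=r(A)+r[\,A,\,B\,]-i_-(M)$. (g) $X\succcurlyeq Y$ for all $X\in\mathcal{S}$ and $Y\in\mathcal{T}$ if and only if $i_+(N)=i_+(M)+r(A)-n$.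 (h) There exist $X\in\mathcal{S}$ and $Y\in\mathcal{T}$ such that $X\prec Y$ if and only if $i_+(N)=i_+(M)+r(A)$. (i) $X\prec Y$ for all $X\in\mathcal{S}$ and $Y\in\mathcal{T}$ if and only if $i_+(N)=r(A)+r[\,A,\,B\,]-i_-(M)+n$. (j) There exist $X\in\mathcal{S}$ and $Y\in\mathcal{T}$ such that $X\preccurlyeq Y$ if and only if $i_-(N)=r(A)+r[\,A,\,B\,]-i_+(M)$. (k) $X\preccurlyeq Y$ for all $X\in\mathcal{S}$ and $Y\in\mathcal{T}$ if and only if $i_-(N)=i_-(M)+r(A)-n$. Under the condition $B\succcurlyeq0$, the following hold: (l) There exist $X\in\mathcal{S}$ and $Y\in\mathcal{T}$ such that $X-Y$ is nonsingular if and only if $r[\,A,\,BA\,]\geqslant 3r(A)-n$. (m) $X-Y$ is nonsingular for all $X\in\mathcal{S}$ and $Y\in\mathcal{T}$ if and only if $r[\,A,\,BA\,]=r(A)+n$. (n) There exist $X\in\mathcal{S}$ and $Y\in\mathcal{T}$ such that $X=Y$ if and only if $\mathscr{R}(BA)\subseteq\mathscr{R}(A)$. (o) There exist $X\in\mathcal{S}$ and $Y\in\mathcal{T}$ such that $X\succ Y$ if and only if $r[\,A,\,BA\,]=2r(A)$. (p) $X\succ Y$ for all $X\in\mathcal{S}$ and $Y\in\mathcal{T}$ if and only if $r[\,A,\,BA\,]=r(A)+n$. (q) There always exist $X\in\mathcal{S}$ and $Y\in\mathcal{T}$ such that $X\succcurlyeq Y$. (r) $X\succcurlyeq Y$ for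 all $X\in\mathcal{S}$ and $Y\in\mathcal{T}$ if and only if $r(A)=n$. (s) There exist $X\in\mathcal{S}$ and $Y\in\mathcal{T}$ such that $X\prec Y$ if and only if $A=0$. (t) There exist $X\in\mathcal{S}$ and $Y\in\mathcal{T}$ such that $X\preccurlyeq Y$ if and only if $\mathscr{R}(BA)\subseteq\mathscr{R}(A)$. (u) $X\preccurlyeq Y$ for all $X\in\mathcal{S}$ and $Y\in\mathcal{T}$ if and only if $r[\,A,\,BA\,]=2r(A)-n$.
   Context: $\mathbb{C}^{k}_{\mathrm H}$ is the set of $k\times k$ complex Hermitian matrices. $A^*$, $r(A)$ and $\mathscr{R}(A)$ denote the conjugate transpose, rank and range (column space) of $A$; $[\,A,\,B\,]$ is the row block matrix; $\|\cdot\|_F$ is the Frobenius norm. For Hermitian $H$, $i_+(H)$ and $i_-(H)$ are the numbers of positive and negative eigenvalues of $H$ counted with multiplicity; a formula with $i_{\pm}$ and $i_{\mp}$ stands for two formulas, one with all upper signs and one with all lower signs. For Hermitian $H,K$ of the same size, $H\succcurlyeq K$ ($H\succ K$) means $H-K$ is Hermitian positive semidefinite (positive definite); $H\preccurlyeq K$, $H\prec K$ mean $K\succcurlyeq H$, $K\succ H$. *)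

(* Defs.v *)
From HB Require Import structures.
From mathcomp Require Import all_boot all_order all_algebra.
From mathcomp Require Import spectral.
From mathcomp Require Export reals complex.

Set Implicit Arguments.
Unset Strict Implicit.
Unset Printing Implicit Defensive.

Import Order.TTheory GRing.Theory Num.Theory.
Local Open Scope ring_scope.
Local Open Scope sesquilinear_scope.

Section Definitions.
Variable C : numClosedFieldType.

(* The eigenvalues of H repeated according to algebraic multiplicity: the
   roots of its (monic) characteristic polynomial. *)
Definition eigenvalues n (H : 'M[C]_n) : seq C :=
  sval (closed_field_poly_normal (char_poly H)).

(* In a numClosedFieldType, 0 < z (resp. z < 0) entails that z is real. *)
Definition ipos n (H : 'M[C]_n) : nat := count (fun z => 0 < z) (eigenvalues H).
Definition ineg n (H : 'M[C]_n) : nat := count (fun z => z < 0) (eigenvalues H).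

Definition psdmx n (H : 'M[C]_n) : Prop :=
  H \is hermsymmx /\ forall x : 'cV[C]_n, 0 <= (x ^t* *m H *m x) 0 0.

Definition pdmx n (H : 'M[C]_n) : Prop :=
  H \is hermsymmx /\
  forall x : 'cV[C]_n, x != 0 -> 0 < (x ^t* *m H *m x) 0 0.

Definition loewner_ge n (H K : 'M[C]_n) : Prop := psdmx (H - K).
Definition loewner_gt n (H K : 'M[C]_n) : Prop := pdmx (H - K).

Definition frobenius_norm m n (A : 'M[C]_(m, n)) : C :=
  sqrtC (\sum_i \sum_j `|A i j| ^+ 2).

Definition least_squares_sol m n (A : 'M[C]_(m, n)) (B : 'M[C]_m)
    (X : 'M[C]_n) : Prop :=
  X \is hermsymmx /\
  forall X' : 'M[C]_n, X' \is hermsymmx ->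
    frobenius_norm (B - A *m X *m A ^t*)
      <= frobenius_norm (B - A *m X' *m A ^t*).

Definition least_rank_sol m n (A : 'M[C]_(m, n)) (B : 'M[C]_m)
    (Y : 'M[C]_n) : Prop :=
  Y \is hermsymmx /\
  forall Y' : 'M[C]_n, Y' \is hermsymmx ->
    (\rank (B - A *m Y *m A ^t*)%R <= \rank (B - A *m Y' *m A ^t*)%R)%N.

(* The maximum (resp. minimum) of f (X - Y) over X in S and Y in T is attained
   and equals z.  It is an integer because the closed formulas involve
   subtractions, which would be truncated in nat. *)
Definition max_diff_eq n (S T : 'M[C]_n -> Prop) (f : 'M[C]_n -> nat)
    (z : int) : Prop :=
  (exists X Y, [/\ S X, T Y & (f (X - Y))%:Z = z]) /\
  (forall X Y, S X -> T Y -> (f (X - Y))%:Z <= z).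

Definition min_diff_eq n (S T : 'M[C]_n -> Prop) (f : 'M[C]_n -> nat)
    (z : int) : Prop :=
  (exists X Y, [/\ S X, T Y & (f (X - Y))%:Z = z]) /\
  (forall X Y, S X -> T Y -> z <= (f (X - Y))%:Z).

Definition exists_pair n (S T : 'M[C]_n -> Prop)
    (P : 'M[C]_n -> 'M[C]_n -> Prop) : Prop :=
  exists X Y, [/\ S X, T Y & P X Y].

Definition forall_pair n (S T : 'M[C]_n -> Prop)
    (P : 'M[C]_n -> 'M[C]_n -> Prop) : Prop :=
  forall X Y, S X -> T Y -> P X Y.

(* Inclusion of ranges, that is, of column spaces; the library's (_ <= _)%MS
   compares row spaces, hence the transposes. *)
Definition range_sub m p q (K : 'M[C]_(m, p)) (L : 'M[C]_(m, q)) : bool :=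
  (K^T <= L^T)%MS.

Definition mxM m n (A : 'M[C]_(m, n)) (B : 'M[C]_m) : 'M[C]_(m + n) :=
  block_mx B A (A ^t*) 0.

Definition mxN m n (A : 'M[C]_(m, n)) (B : 'M[C]_m) : 'M[C]_(m + (n + n)) :=
  block_mx B (row_mx (B *m A) A) (col_mx (A ^t* *m B) (A ^t*)) 0.

End Definitions.

(* Main.v *)
Require Import Defs.
From HB Require Import structures.
From mathcomp Require Import all_boot all_order all_algebra.
From mathcomp Require Import spectral.
From mathcomp Require Import reals complex.
From mathcomp Require Import zify.

(** Let U be the space of rows x with x A = 0, a subspace on which every residual
    B - A X A^* agrees with the form B.

    The residual of X has least norm exactly when it satisfies the normal
    equation A^* (B - A X A^* ) A = 0 ([least_squaresP]), which prescribes
    A X A^*. The residual of Y has least rank exactly when its restriction to the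
    B-orthogonal of U vanishes ([least_rank_reduction]), which prescribes
    J Y J^* for a certain k x n matrix J of full rank whose rows come from the
    row space of A. As J Y J^* is a compression of A Y A^*, the differences X - Y are exactly the
    Hermitian matrices Z with J Z J^* = K for one fixed K ([difference_set]).
    In a basis extending the rows of J, such a Z has K as its leading k x k block
    and is free elsewhere. Hence each inertia of Z ranges from that of K to that
    of K plus n - k, and the rank of Z from rank K to min (n, rank K + 2 (n - k))
    ([extremal_values]).

    It remains to express k and the inertia of K by the matrices M and N of the
    statement. Both are bordered matrices, and the tool is [ipos_split]: the
    inertia of a Hermitian form is the sum of its inertias on a subspace and on
    the orthogonal of that subspace, plus one hyperbolic plane for each dimension
    of the radical of the first restriction which the whole form does not kill.
    The same formula governs the minimal rank of the residual, so that k and K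
    come out in the invariants that also appear in M and N, namely
      k + r [A, B] = r (M),
      i_+ (N) + k = r (A) + i_+ (M) + i_- (K)
    and the last identity with both signs exchanged. When B is semidefinite they
    reduce to k = r (A), i_+ (K) = r [A, BA] - r (A) and i_- (K) = 0.

    Eigenvalues enter only through the spectral theorem ([spectral_split]), which
    writes H as a difference of two Gram matrices P^* P - Q^* Q with as many rows
    in P and Q as H has positive and negative eigenvalues; the rest is linear
    algebra resting on the dimension count [rank_indef_le].

    The listed equivalences say that an extremal rank or inertia is 0 or n:
    Z is invertible when its rank is n, definite when one inertia is n, and
    semidefinite when the other is 0. *)

Set Implicit Arguments.
Unset Strict Implicit.
Unset Printing Implicit Defensive.

Import Order.TTheory GRing.Theory Num.Theory.
Local Open Scope ring_scope.
Local Open Scope sesquilinear_scope.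

(** Ranks and inertias of convertible matrices may be written differently;
    naming each of them turns equal ones into a single atom for [lia]. *)
Ltac mxlia := repeat match goal with
  | |- context [@mxrank ?F ?m ?n ?A] =>
      let x := fresh "x" in set x := (@mxrank F m n A); clearbody x
  | |- context [@ipos ?F ?n ?A] =>
      let x := fresh "x" in set x := (@ipos F n A); clearbody x
  | |- context [@ineg ?F ?n ?A] =>
      let x := fresh "x" in set x := (@ineg F n A); clearbody x
  end; lia.

Section HermitianMatrices.
Variable C : numClosedFieldType.

(** * Conjugate transposes and Hermitian matrices *)

Lemma ctM m n p (A : 'M[C]_(m, n)) (B : 'M[C]_(n, p)) :
  (A *m B) ^t* = B ^t* *m A ^t*.
Proof. by rewrite trmx_mul map_mxM. Qed.

Lemma ctD m n (A B : 'M[C]_(m, n)) : (A + B) ^t* = A ^t* + B ^t*.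
Proof. by rewrite linearD map_mxD. Qed.

Lemma ctN m n (A : 'M[C]_(m, n)) : (- A) ^t* = - A ^t*.
Proof. by rewrite linearN map_mxN. Qed.

Lemma ct0 m n : (0 : 'M[C]_(m, n)) ^t* = 0.
Proof. by rewrite trmx0 map_mx0. Qed.

Lemma ct1 n : (1%:M : 'M[C]_n) ^t* = 1%:M.
Proof. by rewrite trmx1 map_mx1. Qed.

Lemma ct_row m n p (A : 'M[C]_(m, n)) (B : 'M[C]_(m, p)) :
  (row_mx A B) ^t* = col_mx (A ^t*) (B ^t*).
Proof. by rewrite tr_row_mx map_col_mx. Qed.

Lemma ct_col m n p (A : 'M[C]_(m, n)) (B : 'M[C]_(p, n)) :
  (col_mx A B) ^t* = row_mx (A ^t*) (B ^t*).
Proof. by rewrite tr_col_mx map_row_mx. Qed.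

Lemma ct_block m n p q (A : 'M[C]_(m, n)) (B : 'M[C]_(m, p))
    (D : 'M[C]_(q, n)) (E : 'M[C]_(q, p)) :
  (block_mx A B D E) ^t* = block_mx (A ^t*) (D ^t*) (B ^t*) (E ^t*).
Proof. by rewrite tr_block_mx map_block_mx. Qed.

Lemma mxrank_ct m n (A : 'M[C]_(m, n)) : \rank (A ^t*) = \rank A.
Proof. by rewrite mxrank_map mxrank_tr. Qed.

Lemma hermP n (H : 'M[C]_n) : reflect (H ^t* = H) (H \is hermsymmx).
Proof.
by apply: (iffP (is_hermitianmxP _ _ _)); rewrite expr0 scale1r => /esym.
Qed.

Lemma herm_congr n p (H : 'M[C]_n) (P : 'M[C]_(p, n)) :
  H \is hermsymmx -> P *m H *m P ^t* \is hermsymmx.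
Proof. by move/hermP=> hH; apply/hermP; rewrite !ctM trmxCK hH mulmxA. Qed.

Lemma herm_gram m n (P : 'M[C]_(m, n)) : P ^t* *m P \is hermsymmx.
Proof. by apply/hermP; rewrite !ctM trmxCK. Qed.

Lemma hermN n (H : 'M[C]_n) : H \is hermsymmx -> - H \is hermsymmx.
Proof. by move/hermP=> hH; apply/hermP; rewrite ctN hH. Qed.

Lemma hermD n (H K : 'M[C]_n) :
  H \is hermsymmx -> K \is hermsymmx -> H + K \is hermsymmx.
Proof. by move=> /hermP hH /hermP hK; apply/hermP; rewrite ctD hH hK. Qed.

Lemma hermB n (H K : 'M[C]_n) :
  H \is hermsymmx -> K \is hermsymmx -> H - K \is hermsymmx.
Proof. by move=> hH hK; rewrite hermD ?hermN. Qed.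

Lemma herm0 n : (0 : 'M[C]_n) \is hermsymmx.
Proof. by apply/hermP; rewrite ct0. Qed.

Lemma herm1 n : (1%:M : 'M[C]_n) \is hermsymmx.
Proof. by apply/hermP; rewrite ct1. Qed.

Lemma herm_diag n p (H : 'M[C]_n) (K : 'M[C]_p) :
  H \is hermsymmx -> K \is hermsymmx -> block_mx H 0 0 K \is hermsymmx.
Proof. by move=> /hermP h /hermP k; apply/hermP; rewrite ct_block h k !ct0. Qed.

Lemma herm_border p q (G : 'M[C]_p) (B : 'M[C]_(p, q)) : G \is hermsymmx ->
  block_mx G B (B ^t*) 0 \is hermsymmx.
Proof. by move=> /hermP h; apply/hermP; rewrite ct_block h trmxCK ct0. Qed.

Lemma herm_flip m n p (H : 'M[C]_m) (A : 'M[C]_(n, m)) (B : 'M[C]_(p, m)) :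
  H \is hermsymmx -> A *m H *m B ^t* = (B *m H *m A ^t*) ^t*.
Proof. by move=> /hermP hH; rewrite !ctM trmxCK hH mulmxA. Qed.

Lemma congrM p q r (P : 'M[C]_(p, q)) (Q : 'M[C]_(q, r)) (H : 'M[C]_r) :
  (P *m Q) *m H *m (P *m Q) ^t* = P *m (Q *m H *m Q ^t*) *m P ^t*.
Proof. by rewrite ctM !mulmxA. Qed.

(** * Gram matrices, kernels and ranks *)

Lemma gram_ge0 m n (P : 'M[C]_(m, n)) i : 0 <= (P *m P ^t*) i i.
Proof. by rewrite mxE sumr_ge0 // => j _; rewrite !mxE mul_conjC_ge0. Qed.

(** The i-th diagonal entry of [P P^*] is the squared length of row i of P. *)
Lemma gram_eq0_diag m n (P : 'M[C]_(m, n)) :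
  (forall i, (P *m P ^t*) i i <= 0) -> P = 0.
Proof.
move=> h; apply/matrixP=> i j; rewrite mxE.
have /eqP := le_anti (introT andP (conj (h i) (gram_ge0 P i))).
rewrite mxE psumr_eq0 => [/allP/(_ j)|k _]; rewrite !mxE ?mul_conjC_ge0 //.
by rewrite mem_index_enum mul_conjC_eq0 => /(_ isT)/eqP.
Qed.

Lemma gram_eq0 m n (P : 'M[C]_(m, n)) : P *m P ^t* = 0 -> P = 0.
Proof. by move=> h; apply: gram_eq0_diag => i; rewrite h mxE. Qed.

Lemma gram_add_eq0 m n p (P : 'M[C]_(m, n)) (Q : 'M[C]_(m, p)) :
  P *m P ^t* = - (Q *m Q ^t*) -> P = 0 /\ Q = 0.
Proof.
move=> h; suff P0 : P = 0.
  split=> //; apply: gram_eq0; apply/eqP.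
  by rewrite -oppr_eq0 -h P0 mul0mx.
by apply: gram_eq0_diag => i; rewrite h mxE oppr_le0 gram_ge0.
Qed.

Lemma mxrank_le_ker m n p (A : 'M[C]_(m, n)) (B : 'M[C]_(m, p)) :
  kermx A *m B = 0 -> (\rank B <= \rank A)%N.
Proof.
move/sub_kermxP/mxrankS; rewrite !mxrank_ker.
by have := rank_leq_row A; have := rank_leq_row B; lia.
Qed.

(** Rank-nullity for right multiplication by P on the row space of G: the
    combinations of rows of G that P kills are those with coefficients in the
    kernel of [G P]. *)
Lemma rank_kermxM m n p (G : 'M[C]_(m, n)) (P : 'M[C]_(n, p)) :
  \rank G = (\rank (G *m P) + \rank (kermx (G *m P) *m G))%N.
Proof.
rewrite -(mxrank_mul_ker G P); congr addn; apply/eqmx_rank/andP; split.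
  have /submxP[z hz] := capmxSl G (kermx P).
  rewrite hz submxMr //; apply/sub_kermxP; rewrite mulmxA -hz.
  by apply/sub_kermxP; rewrite capmxSr.
rewrite sub_capmx submxMl; apply/sub_kermxP.
by rewrite -mulmxA mulmx_ker.
Qed.

Lemma mxrank_ctM m n (P : 'M[C]_(m, n)) : \rank (P *m P ^t*) = \rank P.
Proof.
apply/eqP; rewrite eqn_leq mxrankM_maxl; apply: mxrank_le_ker.
by apply: gram_eq0; rewrite ctM mulmxA -(mulmxA (kermx _)) mulmx_ker mul0mx.
Qed.

Lemma mxrank_Mct m n (P : 'M[C]_(m, n)) : \rank (P ^t* *m P) = \rank P.
Proof. by rewrite -{2}(trmxCK P) mxrank_ctM mxrank_ct. Qed.

(** A and [A^* A] have the same rank, hence the same row space. *)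
Lemma gram_factor m n (A : 'M[C]_(m, n)) : exists Z, A = Z *m (A ^t* *m A).
Proof.
apply/submxP; have := mxrank_leqif_eq (submxMl (A ^t*) A).
by rewrite mxrank_Mct => -[_]; rewrite eqxx => /esym/andP[].
Qed.

(** A space of columns is its own double annihilator. *)
Lemma kermx_mul_eq0 m n p (G : 'M[C]_(m, n)) (Y : 'M[C]_(m, p)) :
  kermx G *m Y = 0 -> exists Z, Y = G *m Z.
Proof.
move=> h; have /submxP[Z /(congr1 trmx)] : (Y^T <= G^T)%MS; last first.
  by rewrite trmx_mul !trmxK => ->; exists Z^T.
have e : (G^T :=: kermx (kermx G)^T)%MS.
  apply/eqmxP; rewrite -mxrank_leqif_eq; last first.
    by apply/sub_kermxP; rewrite -trmx_mul mulmx_ker trmx0.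
  by rewrite mxrank_ker !mxrank_tr mxrank_ker subKn // rank_leq_row.
by rewrite e; apply/sub_kermxP; rewrite -trmx_mul h trmx0.
Qed.

Lemma rank_row_kermx m n p (A : 'M[C]_(m, n)) (B : 'M[C]_(m, p)) :
  \rank (row_mx A B) = (\rank A + \rank (kermx A *m B))%N.
Proof.
rewrite (rank_kermxM _ (col_mx 1%:M 0)) mul_row_col mulmx1 mulmx0 addr0.
by rewrite mul_mx_row mulmx_ker rank_row_0mx.
Qed.

Lemma rank_row_mxC p q r (X : 'M[C]_(p, q)) (Y : 'M[C]_(p, r)) :
  \rank (row_mx X Y) = \rank (row_mx Y X).
Proof.
rewrite -[LHS]mxrank_tr -[RHS]mxrank_tr !tr_row_mx -!addsmxE.
by rewrite addsmxC.
Qed.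

(** The columns of F are orthogonal to those of K, so nothing cancels in [K - F
    F^*]. *)
Lemma rank_sub_gram k l (K : 'M[C]_k) (F : 'M[C]_(k, l)) :
  K \is hermsymmx -> K *m F = 0 ->
  \rank (K - F *m F ^t*) = (\rank K + \rank F)%N.
Proof.
move=> /hermP hK KF; have FK : F ^t* *m K = 0 by rewrite -{1}hK -ctM KF ct0.
have <- : \rank (row_mx K F) = (\rank K + \rank F)%N.
  rewrite -mxrank_Mct ct_row mul_col_row hK KF FK rank_diag_block_mx -{1}hK.
  by rewrite !mxrank_Mct.
apply/eqP; rewrite eqn_leq; apply/andP; split.
  have -> : K - F *m F ^t* = row_mx K F *m col_mx 1%:M (- F ^t*).
    by rewrite mul_row_col mulmx1 mulmxN.
  exact: mxrankM_maxl.
apply: mxrank_le_ker; have := mulmx_ker (K - F *m F ^t*).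
move: (kermx _) => X; rewrite mulmxBr mulmxA => /eqP; rewrite subr_eq0 => /eqP e.
have XFF : X *m F *m F ^t* = 0.
  apply: gram_eq0; rewrite !ctM trmxCK -{1}e.
  by rewrite !mulmxA -(mulmxA X) KF mulmx0 !mul0mx.
rewrite mul_mx_row e XFF (gram_eq0 (P := X *m F)) ?row_mx0 //.
by rewrite ctM mulmxA XFF mul0mx.
Qed.

(** The inequality behind all later bounds on inertia. If a row x is orthogonal
    to the columns of [N P^*] and of [Q'^*], then [x N H N^* x^*] is minus a
    squared length by the first decomposition and a squared length by the
    second; both lengths vanish and [x N H = 0]. Hence [N H] has rank at most
    the number [a + b'] of those columns. *)
Lemma rank_indef_le m n a b a' b' (H : 'M[C]_m) (N : 'M[C]_(n, m))
    (P : 'M[C]_(a, m)) (Q : 'M[C]_(b, m))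
    (P' : 'M[C]_(a', n)) (Q' : 'M[C]_(b', n)) :
  H = P ^t* *m P - Q ^t* *m Q ->
  N *m H *m N ^t* = P' ^t* *m P' - Q' ^t* *m Q' ->
  (\rank (N *m H) <= a + b')%N.
Proof.
move=> hH hN.
apply: (@leq_trans (\rank (row_mx (N *m P ^t*) (Q' ^t*)))); last exact: rank_leq_col.
apply: mxrank_le_ker; set X := kermx _.
have : X *m row_mx (N *m P ^t*) (Q' ^t*) = 0 by rewrite mulmx_ker.
rewrite mul_mx_row -row_mx0 => /eq_row_mx[].
rewrite mulmxA => h1 h2; move: (X) h1 h2 => {}X h1 h2.
have : X *m (N *m H *m N ^t*) *m X ^t* = X *m (N *m H *m N ^t*) *m X ^t* by [].
rewrite {1}hN hH !mulmxBr !mulmxBl !mulmxBr !mulmxBl !mulmxA h1 h2 !mul0mx subr0 sub0r.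
have -> : X *m P' ^t* *m P' *m X ^t* = (X *m P' ^t*) *m (X *m P' ^t*) ^t*.
  by rewrite ctM trmxCK mulmxA.
have -> : X *m N *m Q ^t* *m Q *m N ^t* *m X ^t*
  = (X *m N *m Q ^t*) *m (X *m N *m Q ^t*) ^t*.
  by rewrite !ctM trmxCK !mulmxA.
by case/gram_add_eq0 => _ ->; rewrite mul0mx subr0.
Qed.

(** * Inertia and sums of squares *)

(** H is similar to its spectral diagonal, so both have the same characteristic
    polynomial, and a split polynomial determines its roots up to order. *)
Lemma count_eigenvalues n (H : 'M[C]_n) (p : pred C) : H \is hermsymmx ->
  count p (eigenvalues H) = #|[set i | p (spectral_diag H 0 i)]|.
Proof.
move=> hH; have /orthomx_spectralP := hermitian_normalmx hH.
set P := spectralmx H; set d := spectral_diag H => e.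
rewrite /eigenvalues; case: closed_field_poly_normal => s /=.
rewrite (monicP (char_poly_monic _)) scale1r.
have -> : char_poly H = \prod_(z <- [seq d 0 i | i <- enum 'I_n]) ('X - z%:P).
  rewrite big_map big_enum /=.
  have -> : \prod_i ('X - (d 0 i)%:P) = char_poly (diag_mx d).
    rewrite char_poly_trig ?diag_mx_is_trig //.
    by apply: eq_bigr => i _; rewrite mxE eqxx.
  rewrite {1}e /char_poly.
  have -> : char_poly_mx (invmx P *m diag_mx d *m P)
    = map_mx polyC (invmx P) *m char_poly_mx (diag_mx d) *m map_mx polyC P.
    rewrite /char_poly_mx mulmxBr mulmxBl -!map_mxM /= scalar_mxC -!mulmxA -map_mxM.
    by rewrite mulVmx ?spectral_unit // map_mx1 mulmx1.
  rewrite !det_mulmx mulrAC -det_mulmx -map_mxM mulVmx ?spectral_unit //.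
  by rewrite map_mx1 det1 mul1r.
move/prod_XsubC_eq/permP => <-.
rewrite count_map cardE enumT /= -size_filter; congr size.
by rewrite /enum_mem; apply: eq_filter => i /=; rewrite !inE.
Qed.

(** W consists of the rows of P indexed by A, scaled by the square roots of the
    entries of d. *)
Lemma diag_gram_on n (P : 'M[C]_n) (d : 'rV[C]_n) (A : {set 'I_n}) :
  (forall i, i \in A -> 0 <= d 0 i) ->
  exists W : 'M[C]_(#|A|, n),
    W ^t* *m W = P ^t* *m diag_mx (\row_i (d 0 i *+ (i \in A))) *m P.
Proof.
move=> dA; exists (\matrix_(i, j) (sqrtC (d 0 (enum_val i)) * P (enum_val i) j)).
apply/matrixP=> j k; rewrite mul_mx_diag !mxE.
rewrite [RHS](bigID (mem A)) /= [X in _ + X]big1 ?addr0 => [|i /negPf hi]; last first.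
  by rewrite !mxE hi mulr0 mul0r.
rewrite [RHS]big_enum_val; apply: eq_bigr => i _; rewrite !mxE.
have hi := enum_valP i; have hd := dA _ hi; rewrite hi mulr1n.
rewrite rmorphM /= (conj_Creal (sqrtC_real hd)) mulrACA -expr2 sqrtCK.
by rewrite mulrA (mulrC (d _ _)).
Qed.

Lemma card_le_rank_diag n (d : 'rV[C]_n) :
  (#|[set i | d 0%R i != 0%R]| <= \rank (diag_mx d))%N.
Proof.
set A := [set i | _]; pose S : 'M[C]_(#|A|, n) := \matrix_(i, j) (enum_val i == j)%:R.
have <- : \rank (S *m (diag_mx d *m (diag_mx (\row_i (d 0 i)^-1) *m S^T))) = #|A|.
  rewrite [X in mxrank X](_ : _ = 1%:M) ?mxrank1 //; apply/matrixP=> i j.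
  rewrite !mul_diag_mx !mxE (bigD1 (enum_val i)) //= big1 ?addr0 => [|k hk].
    have := enum_valP i; rewrite !mxE eqxx inE => hd.
    by rewrite mul1r mulrA mulfV // mul1r (inj_eq enum_val_inj) eq_sym.
  by rewrite !mxE eq_sym (negPf hk) mul0r.
apply: leq_trans (mxrankM_maxr _ _) _; exact: mxrankM_maxl.
Qed.

(** The spectral theorem, with the positive and the negative eigenvalues
    grouped. Together with [rank_inertia] this is all that is used about
    eigenvalues. *)
Lemma spectral_split n (H : 'M[C]_n) : H \is hermsymmx ->
  exists (P : 'M[C]_(ipos H, n)) (Q : 'M[C]_(ineg H, n)),
    H = P ^t* *m P - Q ^t* *m Q.
Proof.
move=> hH; have /orthomx_spectralP := hermitian_normalmx hH.
have /mxOverP := hermitian_spectral_diag_real hH.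
rewrite /ipos /ineg !count_eigenvalues //.
set P := spectralmx H; set d := spectral_diag H => dR e.
have [i|U hU] := @diag_gram_on _ P d [set i | 0 < d 0 i].
  by rewrite inE => /ltW.
have [i|V hV] := @diag_gram_on _ P (- d) [set i | d 0 i < 0].
  by rewrite inE !mxE oppr_ge0 => /ltW.
exists U, V; rewrite hU hV -mulmxBl -mulmxBr -linearB {1}e.
rewrite invmx_unitary ?spectral_unitarymx //; congr (_ *m diag_mx _ *m _).
apply/rowP=> i; rewrite !mxE !inE.
by case: (real_ltgt0P (dR 0 i)) => [||->]; rewrite ?mulr1n ?mulr0n ?subr0 ?sub0r ?opprK.
Qed.

Lemma rank_inertia n (H : 'M[C]_n) : H \is hermsymmx ->
  \rank H = (ipos H + ineg H)%N.
Proof.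
move=> hH; have /orthomx_spectralP := hermitian_normalmx hH.
have /mxOverP := hermitian_spectral_diag_real hH.
rewrite /ipos /ineg !count_eigenvalues //.
set P := spectralmx H; set d := spectral_diag H => dR e.
rewrite {1}e mxrankMfree ?row_free_unit ?spectral_unit //.
rewrite eqmxMfull ?row_full_unit ?unitmx_inv ?spectral_unit //.
apply/eqP; rewrite eqn_leq; apply/andP; split; last first.
  apply: leq_trans (card_le_rank_diag d).
  rewrite -cardsUI [X in (_ + X)%N](_ : _ = 0%N); last first.
    apply: eq_card0 => i; rewrite !inE; apply/negP => /andP[h1 h2].
    by have := lt_trans h1 h2; rewrite ltxx.
  rewrite addn0; apply/subset_leq_card/subsetP=> i.
  by rewrite !inE => /orP[/gt_eqF|/lt_eqF] ->.
have [U [V hUV]] := spectral_split hH.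
rewrite -(mxrankMfree (diag_mx d) (_ : row_free P)) ?row_free_unit ?spectral_unit //.
rewrite -(@eqmxMfull _ _ _ _ (invmx P)) ?row_full_unit ?unitmx_inv ?spectral_unit //.
rewrite mulmxA -e -(count_eigenvalues (fun z => 0 < z)) //.
rewrite -(count_eigenvalues (fun z => z < 0)) // [X in mxrank X]hUV -mulNmx -mul_row_col.
apply: leq_trans (mxrankM_maxl _ _) _; exact: rank_leq_col.
Qed.

Lemma rankM_le_inertia m n (H : 'M[C]_m) (N : 'M[C]_(n, m)) : H \is hermsymmx ->
  (\rank (N *m H) <= ipos H + ineg (N *m H *m N ^t*))%N.
Proof.
move=> hH; have [U [V e]] := spectral_split hH.
have [U' [V' e']] := spectral_split (herm_congr N hH).
exact: rank_indef_le e e'.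
Qed.

(** Half of Sylvester's law of inertia: no decomposition of H as a difference of
    Gram matrices has fewer positive squares than the spectral one. It is
    [rank_indef_le] for the given decomposition and the spectral one. *)
Lemma ipos_min n a b (H : 'M[C]_n) (P : 'M[C]_(a, n)) (Q : 'M[C]_(b, n)) :
  H = P ^t* *m P - Q ^t* *m Q -> (ipos H <= a)%N.
Proof.
move=> e; have hH : H \is hermsymmx by rewrite e hermB ?herm_gram.
have [U [V e']] := spectral_split hH.
have e1 : 1%:M *m H *m 1%:M ^t* = U ^t* *m U - V ^t* *m V.
  by rewrite ct1 mul1mx mulmx1.
by have := rank_indef_le e e1; rewrite mul1mx rank_inertia // leq_add2r.
Qed.

Lemma ineg_min n a b (H : 'M[C]_n) (P : 'M[C]_(a, n)) (Q : 'M[C]_(b, n)) :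
  H = P ^t* *m P - Q ^t* *m Q -> (ineg H <= b)%N.
Proof.
move=> e; have hH : H \is hermsymmx by rewrite e hermB ?herm_gram.
have [U [V e']] := spectral_split hH.
have e1 : - H = Q ^t* *m Q - P ^t* *m P by rewrite e opprB.
have e2 : 1%:M *m (- H) *m 1%:M ^t* = V ^t* *m V - U ^t* *m U.
  by rewrite ct1 mul1mx mulmx1 {1}e' opprB.
have := rank_indef_le e1 e2.
by rewrite mul1mx mxrank_opp rank_inertia // addnC leq_add2r.
Qed.

(** This reduces statements on negative eigenvalues to statements on positive
    ones. *)
Lemma ineg_ipos n (H : 'M[C]_n) : H \is hermsymmx -> ineg H = ipos (- H).
Proof.
move=> hH; have hN := hermN hH.
have [U [V e]] := spectral_split hH; have [U' [V' e']] := spectral_split hN.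
have : - H = V ^t* *m V - U ^t* *m U by rewrite {1}e opprB.
move/ipos_min => h1.
have : H = V' ^t* *m V' - U' ^t* *m U' by rewrite -opprB -e' opprK.
by move/ineg_min => h2; apply/eqP; rewrite eqn_leq h2.
Qed.

Lemma inegN n (H : 'M[C]_n) : H \is hermsymmx -> ineg (- H) = ipos H.
Proof. by move=> hH; rewrite ineg_ipos ?hermN ?opprK. Qed.

Lemma ipos1 n : ipos (1%:M : 'M[C]_n) = n.
Proof.
(* - 1 has no positive squares: write it with a Gram matrix of no rows. *)
have /ipos_min : - 1%:M = (0 : 'M[C]_(0, n)) ^t* *m 0 - 1%:M ^t* *m (1%:M : 'M[C]_n).
  by rewrite ct1 mulmx0 mulmx1 sub0r.
rewrite -ineg_ipos ?herm1 // leqn0 => /eqP h0.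
by have := rank_inertia (herm1 n); rewrite mxrank1 h0 addn0.
Qed.

(** * Inertia under congruence *)

Lemma ipos_congr_le n p (H : 'M[C]_n) (P : 'M[C]_(p, n)) : H \is hermsymmx ->
  (ipos (P *m H *m P ^t*) <= ipos H)%N.
Proof.
move=> /spectral_split[U [V e]].
apply: (@ipos_min _ _ _ _ (U *m P ^t*) (V *m P ^t*)).
by rewrite {1}e mulmxBr mulmxBl !ctM !trmxCK !mulmxA.
Qed.

Lemma ineg_congr_le n p (H : 'M[C]_n) (P : 'M[C]_(p, n)) : H \is hermsymmx ->
  (ineg (P *m H *m P ^t*) <= ineg H)%N.
Proof.
move=> hH; rewrite !ineg_ipos ?herm_congr // -mulNmx -mulmxN.
by apply: ipos_congr_le; apply: hermN.
Qed.

Lemma ipos_congr n p (H : 'M[C]_n) (P : 'M[C]_(p, n)) (P' : 'M[C]_(n, p)) :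
  H \is hermsymmx -> P' *m P = 1%:M -> ipos (P *m H *m P ^t*) = ipos H.
Proof.
move=> hH hP; apply/eqP; rewrite eqn_leq ipos_congr_le //=.
have {1}-> : H = P' *m (P *m H *m P ^t*) *m P' ^t*.
  by rewrite !mulmxA hP mul1mx -mulmxA -ctM hP ct1 mulmx1.
by rewrite ipos_congr_le // herm_congr.
Qed.

Lemma ineg_congr n p (H : 'M[C]_n) (P : 'M[C]_(p, n)) (P' : 'M[C]_(n, p)) :
  H \is hermsymmx -> P' *m P = 1%:M -> ineg (P *m H *m P ^t*) = ineg H.
Proof.
move=> hH hP; rewrite !ineg_ipos ?herm_congr // -(ipos_congr (hermN hH) hP).
by rewrite mulmxN mulNmx.
Qed.

Lemma ipos_congr2 n p (H : 'M[C]_n) (K : 'M[C]_p) (P : 'M[C]_(p, n)) (Q : 'M[C]_(n, p)) :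
  H \is hermsymmx -> K \is hermsymmx ->
  K = P *m H *m P ^t* -> H = Q *m K *m Q ^t* -> ipos K = ipos H.
Proof.
move=> hH hK e e'; apply/eqP; rewrite eqn_leq {1}e ipos_congr_le //=.
by rewrite {1}e' ipos_congr_le.
Qed.

Lemma ineg_congr2 n p (H : 'M[C]_n) (K : 'M[C]_p) (P : 'M[C]_(p, n)) (Q : 'M[C]_(n, p)) :
  H \is hermsymmx -> K \is hermsymmx ->
  K = P *m H *m P ^t* -> H = Q *m K *m Q ^t* -> ineg K = ineg H.
Proof.
move=> hH hK e e'; apply/eqP; rewrite eqn_leq {1}e ineg_congr_le //=.
by rewrite {1}e' ineg_congr_le.
Qed.

Lemma ipos_diag_le n p (H : 'M[C]_n) (K : 'M[C]_p) :
  H \is hermsymmx -> K \is hermsymmx ->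
  (ipos (block_mx H 0 0 K) <= ipos H + ipos K)%N.
Proof.
move=> /spectral_split[U [V e]] /spectral_split[U' [V' e']].
apply: (@ipos_min _ _ _ _ (block_mx U 0 0 U') (block_mx V 0 0 V')).
rewrite {1}e {1}e' !ct_block !ct0 !mulmx_block !(mul0mx, mulmx0, addr0, add0r).
by rewrite opp_block_mx add_block_mx !subr0.
Qed.

(** Juxtaposing decompositions gives an upper bound for each sign, and the two
    bounds add up to the rank. *)
Lemma ipos_diag n p (H : 'M[C]_n) (K : 'M[C]_p) :
  H \is hermsymmx -> K \is hermsymmx ->
  ipos (block_mx H 0 0 K) = (ipos H + ipos K)%N.
Proof.
move=> hH hK; have hD := herm_diag hH hK.
have := ipos_diag_le hH hK; have := ipos_diag_le (hermN hH) (hermN hK).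
have <- : - block_mx H 0 0 K = block_mx (- H) 0 0 (- K).
  by rewrite opp_block_mx !oppr0.
rewrite -!ineg_ipos //.
have := rank_inertia hH; have := rank_inertia hK; have := rank_inertia hD.
rewrite rank_diag_block_mx; lia.
Qed.

(** * Definite and semidefinite matrices *)

Lemma row_congrE n p (H : 'M[C]_n) (X : 'M[C]_(p, n)) i :
  (((row i X) ^t*) ^t* *m H *m (row i X) ^t*) 0 0 = (X *m H *m X ^t*) i i.
Proof. by rewrite trmxCK -row_mul !mxE; apply: eq_bigr => j _; rewrite !mxE. Qed.

Lemma gram_of_ineg0 n (H : 'M[C]_n) : H \is hermsymmx -> ineg H = 0%N ->
  exists U : 'M[C]_(ipos H, n), H = U ^t* *m U.
Proof.
move=> hH h0; have [U [V e]] := spectral_split hH; exists U.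
suff V0 : V = 0 by rewrite {1}e V0 mulmx0 subr0.
by apply/eqP; rewrite -mxrank_eq0 -leqn0 -h0 rank_leq_row.
Qed.

(** If H is semidefinite, a row killed by the positive squares has nonpositive,
    hence zero, value under H, and its negative squares vanish too; so the
    positive squares alone carry the rank of H. *)
Lemma psdmxP n (H : 'M[C]_n) : psdmx H <-> H \is hermsymmx /\ ineg H = 0%N.
Proof.
split=> [[hH h]|[hH h0]]; split=> //; last first.
  have [U ->] := gram_of_ineg0 hH h0 => x.
  have := gram_ge0 (x ^t* *m U ^t*) 0.
  by rewrite ctM !trmxCK !mulmxA.
have [U [V e]] := spectral_split hH.
suff: (\rank H <= ipos H)%N by rewrite rank_inertia //; lia.
apply: leq_trans (rank_leq_col (U ^t*)); apply: mxrank_le_ker.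
have : kermx (U ^t*) *m U ^t* = 0 by rewrite mulmx_ker.
move: (kermx _) => X hX; rewrite {1}e mulmxBr !mulmxA hX mul0mx sub0r.
have -> : X *m V ^t* = 0; last by rewrite mul0mx oppr0.
apply: gram_eq0_diag => i; have := h ((row i X) ^t*).
rewrite row_congrE {1}e mulmxBr mulmxBl !mulmxA hX !mul0mx sub0r.
by rewrite mxE oppr_ge0 ctM trmxCK !mulmxA.
Qed.

Lemma pdmxP n (H : 'M[C]_n) : pdmx H <-> H \is hermsymmx /\ ipos H = n.
Proof.
split=> [[hH h]|[hH hn]]; split=> //.
  have [_ h0] : H \is hermsymmx /\ ineg H = 0%N.
    apply/psdmxP; split=> // x; have [->|/h/ltW //] := eqVneq x 0.
    by rewrite mulmx0 mxE.
  suff: \rank H = n by rewrite rank_inertia // h0 addn0.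
  apply/eqP/negP => /negP; rewrite -/(row_free H) -kermx_eq0 => /negP; apply.
  apply/eqP/row_matrixP=> i; rewrite row0; apply/eqP/negP => /negP hi.
  have /h : (row i (kermx H)) ^t* != 0.
    by apply: contra hi => /eqP e; rewrite -[row _ _]trmxCK e ct0.
  by rewrite row_congrE mulmx_ker mul0mx mxE ltxx.
have rH := rank_inertia hH; have := rank_leq_row H.
have h0 : ineg H = 0%N by have := rank_leq_row H; lia.
have [U e] := gram_of_ineg0 hH h0 => rn x x0; rewrite lt_def; apply/andP; split; last first.
  by have /psdmxP[_ ->] : H \is hermsymmx /\ ineg H = 0%N by [].
apply: contra x0 => /eqP hx.
have /gram_eq0_diag hU : forall i, ((x ^t* *m U ^t*) *m (x ^t* *m U ^t*) ^t*) i i <= 0.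
  by move=> i; rewrite ord1 ctM !trmxCK !mulmxA -(mulmxA _ (U ^t*)) -e hx.
have uH : H \in unitmx by rewrite -row_free_unit /row_free rH hn h0 addn0.
have Ux : U *m x = 0 by rewrite -[LHS]trmxCK ctM hU ct0.
by rewrite -(mulKmx uH x) {2}e -!mulmxA Ux !mulmx0.
Qed.

(** * Inertia from a subspace and its orthogonal *)

Section Split.
Variables (m n : nat) (H : 'M[C]_m) (N : 'M[C]_(n, m)).
Hypothesis hH : H \is hermsymmx.
Let F := kermx (H *m N ^t*).

(** Apply [rankM_le_inertia] to the rows of N stacked on those of F: on them the
    form is block diagonal, since F consists of the rows orthogonal to N. *)
Lemma ipos_split_ge :
  (ipos (N *m H *m N ^t*) + ipos (F *m H *m F ^t*) + \rank (N *m H)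
    <= ipos H + \rank (N *m H *m N ^t*))%N.
Proof.
have FN : F *m H *m N ^t* = 0 by rewrite -mulmxA mulmx_ker.
have NF : N *m H *m F ^t* = 0.
  by rewrite herm_flip // FN ct0.
have := rankM_le_inertia (col_mx N F) hH.
rewrite ct_col mul_col_mx mul_col_row NF FN.
have hN := herm_congr N hH; have hF := herm_congr F hH.
have -> : ineg (block_mx (N *m H *m N ^t*) 0 0 (F *m H *m F ^t*))
  = (ineg (N *m H *m N ^t*) + ineg (F *m H *m F ^t*))%N.
  rewrite ineg_ipos ?herm_diag // opp_block_mx !oppr0 ipos_diag ?hermN //.
  by rewrite -!ineg_ipos.
have := rank_inertia hN; have := rank_inertia hF.
suff: (\rank (N *m H) + \rank (F *m H *m F ^t*)
        <= \rank (col_mx (N *m H) (F *m H)))%N by mxlia.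
rewrite -(mxrank_mul_ker (col_mx _ _) (F ^t*)) mul_col_mx NF rank_col_0mx addnC.
rewrite leq_add2l; apply: mxrankS; rewrite sub_capmx; apply/andP; split.
  by rewrite -addsmxE addsmxSl.
by apply/sub_kermxP.
Qed.

(** What [F H] loses when it is restricted to F is orthogonal to F, hence lies
    in the row space of [N H], and it is also orthogonal to N; so it is part of
    what [N H] loses when it is restricted to N. *)
Lemma rank_split_le :
  (\rank H + \rank (N *m H *m N ^t*) + \rank (N *m H *m N ^t*)
   <= \rank (N *m H *m N ^t*) + \rank (F *m H *m F ^t*)
      + (\rank (N *m H) + \rank (N *m H)))%N.
Proof.
have FN : F *m H *m N ^t* = 0 by rewrite -mulmxA mulmx_ker.
have := rank_kermxM H (N ^t*); rewrite -/F.
have -> : \rank (H *m N ^t*) = \rank (N *m H).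
  by rewrite -mxrank_ct ctM trmxCK (hermP _ hH).
move=> ->.
have := mxrank_mul_ker (N *m H) (N ^t*).
have := rank_kermxM (F *m H) (F ^t*).
suff: (\rank (kermx (F *m H *m F ^t*) *m (F *m H))
        <= \rank (N *m H :&: kermx (N ^t*))%MS)%N by mxlia.
set X := kermx _; have : X *m (F *m H *m F ^t*) = 0 by rewrite mulmx_ker.
move: X => X hX; apply: mxrankS; rewrite sub_capmx; apply/andP; split; last first.
  by apply/sub_kermxP; rewrite -mulmxA FN mulmx0.
have [|Z hZ] := @kermx_mul_eq0 _ _ _ (H *m N ^t*) (H *m F ^t* *m X ^t*).
  rewrite -/F !mulmxA -(mulmxA (F *m H)) -ctM herm_flip //.
  by move: hX; rewrite !mulmxA => ->; rewrite ct0.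
apply/submxP; exists (Z ^t*).
have := congr1 (fun X => X ^t*) hZ.
by rewrite /= !ctM !trmxCK (hermP _ hH).
Qed.

End Split.

(** The inertia of a Hermitian form, computed from a subspace N and its
    orthogonal F. Besides the restrictions of H to N and to F, each of the [rank
    (N H) - rank (N H N^* )] dimensions of the radical of the restriction to N
    that H does not kill spans a hyperbolic plane with a vector outside N + F,
    and so counts once for each sign. The lower bounds [ipos_split_ge] for H and
    for - H add up to the upper bound [rank_split_le] on the rank, hence are
    equalities. *)
Lemma ipos_split m n (H : 'M[C]_m) (N : 'M[C]_(n, m)) (F := kermx (H *m N ^t*)) :
  H \is hermsymmx ->
  (ipos H + \rank (N *m H *m N ^t*)
   = ipos (N *m H *m N ^t*) + ipos (F *m H *m F ^t*) + \rank (N *m H))%N.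
Proof.
move=> hH; have hH' := hermN hH.
have hN := herm_congr N hH; have hF := herm_congr F hH.
have := ipos_split_ge N hH; have := ipos_split_ge (- N) hH'; have := rank_split_le N hH.
rewrite !(ctN, mulNmx, mulmxN, opprK) -/F -!ineg_ipos // !mxrank_opp.
rewrite (rank_inertia hH) (rank_inertia hN) (rank_inertia hF).
mxlia.
Qed.

(** Negating N as well as H leaves F unchanged. *)
Lemma ineg_split m n (H : 'M[C]_m) (N : 'M[C]_(n, m)) (F := kermx (H *m N ^t*)) :
  H \is hermsymmx ->
  (ineg H + \rank (N *m H *m N ^t*)
   = ineg (N *m H *m N ^t*) + ineg (F *m H *m F ^t*) + \rank (N *m H))%N.
Proof.
move=> hH; have := ipos_split (- N) (hermN hH).
rewrite !(ctN, mulNmx, mulmxN, opprK) -/F mxrank_opp.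
by rewrite -!ineg_ipos ?herm_congr.
Qed.

(** The last q coordinates span an isotropic space, which contributes the rank
    of B to both signs, and the rows orthogonal to it are those whose first p
    coordinates are killed by B. *)
Lemma ipos_border p q (G : 'M[C]_p) (B : 'M[C]_(p, q)) (L := kermx B) :
  G \is hermsymmx ->
  ipos (block_mx G B (B ^t*) 0) = (\rank B + ipos (L *m G *m L ^t*))%N.
Proof.
move=> hG; have hH := herm_border B hG; set H := block_mx _ _ _ _ in hH *.
pose N : 'M[C]_(q, p + q) := row_mx 0 1%:M.
have NH : N *m H = row_mx (B ^t*) 0.
  by rewrite mul_row_block !mul0mx !mul1mx !add0r.
have HN : H *m N ^t* = col_mx B 0.
  by rewrite -{1}(hermP _ hH) -ctM NH ct_row trmxCK ct0.
have NHN : N *m H *m N ^t* = 0.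
  by rewrite NH ct_row ct0 ct1 mul_row_col mulmx0 mul0mx addr0.
have := ipos_split N hH; rewrite NHN NH rank_row_mx0 mxrank_ct mxrank0 addn0 HN.
have -> : ipos (0 : 'M[C]_q) = 0%N.
  by have := rank_inertia (herm0 q); rewrite mxrank0; mxlia.
set F := kermx _; rewrite add0n => ->; rewrite [LHS]addnC; congr addn.
have hF : F *m col_mx B 0 = 0 by rewrite mulmx_ker.
have /submxP[Z hZ] : (lsubmx F <= L)%MS.
  by apply/sub_kermxP; move: hF; rewrite -{1}[F]hsubmxK mul_row_col mulmx0 addr0.
have FHF : F *m H *m F ^t* = Z *m (L *m G *m L ^t*) *m Z ^t*.
  move: (lsubmx F) (rsubmx F) hZ (hsubmxK F) => Fl Fr hZ <-.
  rewrite ct_row mul_row_block mul_row_col mulmx0 addr0 mulmxDl.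
  have -> : Fl *m B = 0 by rewrite hZ -mulmxA mulmx_ker mulmx0.
  have -> : Fr *m B ^t* *m Fl ^t* = 0.
    by rewrite -mulmxA -ctM hZ -mulmxA mulmx_ker mulmx0 ct0 mulmx0.
  by rewrite mul0mx !addr0 hZ ctM !mulmxA.
have /submxP[Y hY] : (row_mx L 0 <= F)%MS.
  by apply/sub_kermxP; rewrite mul_row_col mulmx0 addr0 mulmx_ker.
have LGL : L *m G *m L ^t* = Y *m (F *m H *m F ^t*) *m Y ^t*.
  by rewrite -congrM -hY ct_row ct0 mul_row_block mul_row_col !mul0mx !mulmx0 !addr0.
by apply: ipos_congr2 FHF LGL; rewrite herm_congr.
Qed.

Lemma ineg_border p q (G : 'M[C]_p) (B : 'M[C]_(p, q)) (L := kermx B) :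
  G \is hermsymmx ->
  ineg (block_mx G B (B ^t*) 0) = (\rank B + ineg (L *m G *m L ^t*))%N.
Proof.
move=> hG; rewrite !ineg_ipos ?herm_border ?herm_congr //.
have <- : L *m (- G) *m L ^t* = - (L *m G *m L ^t*) by rewrite mulmxN mulNmx.
rewrite -ipos_border ?hermN //.
(* Congruence by P changes the sign of the border, so that of - G is restored
   after the whole matrix is negated. *)
pose P : 'M[C]_(p + q) := block_mx 1%:M 0 0 (- 1%:M).
have PP : P *m P = 1%:M.
  rewrite mulmx_block !(mul0mx, mulmx0, mulmx1, addr0, add0r) mulNmx mul1mx opprK.
  by rewrite -scalar_mx_block.
rewrite -(ipos_congr (hermN (herm_border B hG)) PP); congr ipos.
rewrite ct_block ctN !ct0 !ct1 opp_block_mx oppr0 !mulmx_block.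
by rewrite !(mul0mx, mulmx0, mulmx1, mul1mx, addr0, add0r, mulNmx, mulmxN, opprK) oppr0.
Qed.

(** * Hermitian matrices with a prescribed compression *)

Section Fiber.
Variables (k n : nat) (J : 'M[C]_(k, n)).
Hypothesis hJ : row_free J.

(** Passing from Z to [J Z] loses at most n - k of the rank, and the rank of [J
    Z] is bounded by [rankM_le_inertia] for - Z. *)
Lemma fiber_ipos_le Z K : Z \is hermsymmx -> J *m Z *m J ^t* = K ->
  (ipos Z <= ipos K + (n - k))%N.
Proof.
move=> hZ e; have hK : K \is hermsymmx by rewrite -e herm_congr.
have := rankM_le_inertia J (hermN hZ).
rewrite mulmxN mulNmx e mxrank_opp -!ineg_ipos // inegN //.
have := mxrank_mul_min J Z; rewrite (eqP hJ); have := rank_inertia hZ.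
have : (k <= n)%N by rewrite -(eqP hJ) rank_leq_col.
mxlia.
Qed.

Lemma fiber_ineg_le Z K : Z \is hermsymmx -> J *m Z *m J ^t* = K ->
  (ineg Z <= ineg K + (n - k))%N.
Proof.
move=> hZ e; have hK : K \is hermsymmx by rewrite -e herm_congr.
by rewrite !ineg_ipos //; apply: fiber_ipos_le; rewrite ?hermN // mulmxN mulNmx e.
Qed.

Lemma row_free_complement :
  exists (L : 'M[C]_(n - k, n)) (G' : 'M[C]_(n, k + (n - k))),
    col_mx J L *m G' = 1%:M.
Proof.
have rk : \rank (J^C)%MS = (n - k)%N by rewrite mxrank_compl (eqP hJ).
have [L hL] : exists L : 'M[C]_(n - k, n), (L :=: J^C)%MS.
  by rewrite -rk; exists (row_base (J^C)%MS); apply: eq_row_base.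
have full : row_full (col_mx J L).
  by rewrite /row_full -addsmxE (adds_eqmx (eqmx_refl J) hL) (eqP (addsmx_compl_full J)).
have free : row_free (col_mx J L).
  rewrite /row_free (eqP full) subnKC // -(eqP hJ); exact: rank_leq_col.
by have /row_freeP[G' hG] := free; exists L, G'.
Qed.

(** After completing J to a basis, border K by F and by an identity block: the
    Schur complement of the identity is [K - F F^*], which leaves F free to
    adjust rank and inertia. *)
Lemma fiber_border (K : 'M[C]_k) (F : 'M[C]_(k, n - k)) : K \is hermsymmx ->
  exists Z,
  [/\ Z \is hermsymmx, J *m Z *m J ^t* = K,
   (ipos (K - F *m F ^t*)%R + (n - k) <= ipos Z)%N
   & (\rank (K - F *m F ^t*)%R + (n - k) <= \rank Z)%N].
Proof.
move=> hK; have [L [G' hG]] := row_free_complement.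
have JG : J *m G' = row_mx 1%:M 0.
  by move: hG; rewrite mul_col_mx scalar_mx_block block_mxEv => /eq_col_mx[].
set G := col_mx J L in hG.
pose B := block_mx K F (F ^t*) 1%:M.
have hB : B \is hermsymmx.
  by apply/hermP; rewrite ct_block trmxCK ct1 (hermP _ hK).
(* Congruence by T clears the border F. *)
pose T : 'M[C]_(k + (n - k)) := block_mx 1%:M (- F) 0 1%:M.
have TBT : T *m B *m T ^t* = block_mx (K - F *m F ^t*) 0 0 1%:M.
  rewrite ct_block !ct1 ct0 !mulmx_block.
  rewrite !(mul0mx, mulmx0, mulmx1, mul1mx, addr0, add0r, mulNmx, ctN, mulmxN).
  by rewrite !addrN mul0mx subr0.
have hZ : G' *m B *m G' ^t* \is hermsymmx by rewrite herm_congr.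
exists (G' *m B *m G' ^t*); split=> //.
- rewrite !mulmxA JG -mulmxA -ctM JG mul_row_block ct_row mul_row_col.
  by rewrite ct0 ct1 !(mul0mx, mulmx0, mulmx1, mul1mx, addr0, add0r).
- have <- : ipos (T *m B *m T ^t*) = (ipos (K - F *m F ^t*)%R + (n - k))%N.
    by rewrite TBT ipos_diag ?herm1 ?ipos1 // hermB // -{1}[F]trmxCK herm_gram.
  by rewrite (ipos_congr hB hG) ipos_congr_le.
- have <- : \rank (T *m B *m T ^t*) = (\rank (K - F *m F ^t*)%R + (n - k))%N.
    by rewrite TBT rank_diag_block_mx mxrank1.
  rewrite !rank_inertia ?herm_congr // (ipos_congr hB hG) (ineg_congr hB hG).
  by rewrite leq_add ?ipos_congr_le ?ineg_congr_le.
Qed.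

Lemma fiber_min (K : 'M[C]_k) : K \is hermsymmx -> exists Z,
  [/\ Z \is hermsymmx, J *m Z *m J ^t* = K, ipos Z = ipos K & ineg Z = ineg K].
Proof.
move=> hK; have /row_freeP[R hR] := hJ; exists (R *m K *m R ^t*); split.
- by rewrite herm_congr.
- by rewrite !mulmxA hR mul1mx -mulmxA -ctM hR ct1 mulmx1.
- exact: ipos_congr hR.
- exact: ineg_congr hR.
Qed.

(** In [fiber_border], take for F as many independent columns in the kernel of K
    as both this kernel and the width n - k allow; each raises the rank of [K -
    F F^*] by one. *)
Lemma fiber_max_rank (K : 'M[C]_k) : K \is hermsymmx -> exists Z,
  [/\ Z \is hermsymmx, J *m Z *m J ^t* = K
   & \rank Z = minn n (\rank K + (n - k).*2)].
Proof.
move=> hK; set W := row_base (kermx K).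
have WK : W *m K = 0 by apply/sub_kermxP; rewrite eq_row_base.
pose r := minn (\rank (kermx K)) (n - k).
pose F : 'M[C]_(k, n - k) := W ^t* *m (pid_mx r).
have KF : K *m F = 0.
  by rewrite mulmxA -[K *m W ^t*]trmxCK ctM trmxCK (hermP _ hK) WK ct0 mul0mx.
have rF : \rank F = r.
  rewrite eqmxMfull ?rank_pid_mx ?geq_minl ?geq_minr //.
  by rewrite /row_full mxrank_ct eq_row_base.
have [Z [hZ JZ _ rZ]] := fiber_border F hK; exists Z; split=> //.
have := fiber_ipos_le hZ JZ; have := fiber_ineg_le hZ JZ.
have := rank_inertia hZ; have := rank_inertia hK; have := rank_leq_row Z.
have : (k <= n)%N by rewrite -(eqP hJ) rank_leq_col.
have := rank_leq_row K; move: rZ; rewrite rank_sub_gram // rF /r mxrank_ker.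
mxlia.
Qed.

Lemma fiber_max_ipos (K : 'M[C]_k) : K \is hermsymmx -> exists Z,
  [/\ Z \is hermsymmx, J *m Z *m J ^t* = K & ipos Z = (ipos K + (n - k))%N].
Proof.
move=> hK; have [Z [hZ JZ hp _]] := fiber_border 0 hK; exists Z; split=> //.
move: hp; rewrite mul0mx subr0 => hp.
by apply/eqP; rewrite eqn_leq hp fiber_ipos_le.
Qed.

Lemma fiber_max_ineg (K : 'M[C]_k) : K \is hermsymmx -> exists Z,
  [/\ Z \is hermsymmx, J *m Z *m J ^t* = K & ineg Z = (ineg K + (n - k))%N].
Proof.
move=> hK; have [Z [hZ JZ hp]] := fiber_max_ipos (hermN hK).
exists (- Z); rewrite hermN // mulmxN mulNmx JZ opprK; split=> //.
by rewrite inegN // hp ineg_ipos.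
Qed.

End Fiber.

(** * Least-squares solutions *)

(** The squared Frobenius norm, as a trace; it is additive on orthogonal
    summands. *)
Definition fnorm2 m n (A : 'M[C]_(m, n)) := \tr (A *m A ^t*).

Lemma frobenius_le m n (A B : 'M[C]_(m, n)) :
  (frobenius_norm A <= frobenius_norm B) = (fnorm2 A <= fnorm2 B).
Proof.
have e (D : 'M[C]_(m, n)) : \sum_i \sum_j `|D i j| ^+ 2 = fnorm2 D.
  apply: eq_bigr => i _; rewrite mxE; apply: eq_bigr => j _.
  by rewrite !mxE normCK.
have p (D : 'M[C]_(m, n)) : fnorm2 D \is Num.nneg.
  by rewrite nnegrE sumr_ge0 // => i _; apply: gram_ge0.
by rewrite /frobenius_norm !e ler_sqrtC.
Qed.

Lemma fnorm2_le0 m n (A : 'M[C]_(m, n)) : fnorm2 A <= 0 -> A = 0.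
Proof.
move=> h; apply: gram_eq0_diag => i; apply: le_trans h.
by rewrite /fnorm2 /mxtrace (bigD1 i) //= lerDl sumr_ge0 // => j _; apply: gram_ge0.
Qed.

(** The hypothesis on D says that D is orthogonal to all [A W A^*] for the trace
    inner product. *)
Lemma pythagoras m n (A : 'M[C]_(m, n)) (D : 'M[C]_m) (W : 'M[C]_n) :
  D \is hermsymmx -> W \is hermsymmx -> A ^t* *m D *m A = 0 ->
  fnorm2 (D + A *m W *m A ^t*) = fnorm2 D + fnorm2 (A *m W *m A ^t*).
Proof.
move=> /hermP hD hW h; have hE := hermP _ (herm_congr A hW).
rewrite /fnorm2 ctD hE hD mulmxDl !mulmxDr !mxtraceD.
have -> : \tr (D *m (A *m W *m A ^t*)) = 0.
  by rewrite mxtrace_mulC -!mulmxA mxtrace_mulC -mulmxA h mulmx0 mxtrace0.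
have -> : \tr (A *m W *m A ^t* *m D) = 0.
  by rewrite -!mulmxA mxtrace_mulC -!mulmxA [A ^t* *m _]mulmxA h mulmx0 mxtrace0.
by rewrite addr0 add0r.
Qed.

(** With Z as in [gram_factor], [X = Z^* B Z]. *)
Lemma normal_sol_exists m n (A : 'M[C]_(m, n)) (B : 'M[C]_m) : B \is hermsymmx ->
  exists2 X, X \is hermsymmx & A ^t* *m (B - A *m X *m A ^t*) *m A = 0.
Proof.
move=> hB; have [Z hZ] := gram_factor A; exists (Z ^t* *m B *m Z).
  by rewrite -{2}[Z]trmxCK herm_congr.
have hZ' : A ^t* = A ^t* *m A *m Z ^t* by rewrite {1}hZ !ctM trmxCK.
have -> : A ^t* *m (B - A *m (Z ^t* *m B *m Z) *m A ^t*) *m A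
  = A ^t* *m B *m A - (A ^t* *m A *m Z ^t*) *m B *m (Z *m (A ^t* *m A)).
  by rewrite mulmxBr mulmxBl !mulmxA.
by rewrite -hZ -hZ' subrr.
Qed.

Lemma normal_sol_unique m n (A : 'M[C]_(m, n)) (B : 'M[C]_m) X Y :
  A ^t* *m (B - A *m X *m A ^t*) *m A = 0 ->
  A ^t* *m (B - A *m Y *m A ^t*) *m A = 0 ->
  A *m X *m A ^t* = A *m Y *m A ^t*.
Proof.
rewrite !mulmxBr !mulmxBl => /eqP; rewrite subr_eq0 => /eqP e1.
move=> /eqP; rewrite subr_eq0 => /eqP e2.
have [Z hZ] := gram_factor A.
have hZ' : A ^t* = A ^t* *m A *m Z ^t* by rewrite {1}hZ !ctM trmxCK.
have e W : A *m W *m A ^t* = Z *m (A ^t* *m (A *m W *m A ^t*) *m A) *m Z ^t*.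
  by rewrite {1}hZ {2}hZ' !mulmxA.
by rewrite e -e1 e2 -e.
Qed.

(** By Pythagoras a Hermitian solution of the normal equation is a minimizer,
    and every other minimizer leaves the same residual as one such solution. *)
Lemma least_squaresP m n (A : 'M[C]_(m, n)) (B : 'M[C]_m) X : B \is hermsymmx ->
  least_squares_sol A B X <->
  X \is hermsymmx /\ A ^t* *m (B - A *m X *m A ^t*) *m A = 0.
Proof.
move=> hB.
have key U V : U \is hermsymmx -> V \is hermsymmx ->
    A ^t* *m (B - A *m U *m A ^t*) *m A = 0 ->
  fnorm2 (B - A *m V *m A ^t*)
    = fnorm2 (B - A *m U *m A ^t*) + fnorm2 (A *m (U - V) *m A ^t*).
  move=> hU hV h; rewrite -pythagoras ?hermB ?herm_congr //; congr fnorm2.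
  by rewrite mulmxBr mulmxBl addrA subrK.
split=> [[hX h]|[hX h]]; split=> //; last first.
  move=> V hV; rewrite frobenius_le (key X V) // lerDl.
  by rewrite sumr_ge0 // => i _; apply: gram_ge0.
have [X0 h0 e0] := normal_sol_exists A hB.
have := h _ h0; rewrite frobenius_le (key X0 X) // gerDl => /fnorm2_le0.
rewrite mulmxBr mulmxBl => /eqP; rewrite subr_eq0 => /eqP <-; exact: e0.
Qed.

(** * Least-rank solutions and the bordered matrices *)

Section Pencil.
Variables (m n : nat) (A : 'M[C]_(m, n)) (B : 'M[C]_m).
Hypothesis hB : B \is hermsymmx.
Let N := kermx A.
Let L := kermx (row_mx (B *m A) A).

(** Let N span the rows killed by A, and F the rows orthogonal to N for the form
    B. Every residual [H = B - A Y A^*] agrees with B on N, so F is also the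
    orthogonal of N for H, and by [ipos_split] the inertia of H depends on Y
    only through [F H F^*]. The rows of F that A kills lie in the radical of
    this restriction; dividing them out leaves k rows E with [J = E A] of full
    rank. Then [E H E^* = E B E^* - J Y J^*] can be made to vanish, so this is
    what minimizing the rank of H means. *)
Lemma least_rank_reduction :
  exists k (J : 'M[C]_(k, n)) (E : 'M[C]_(k, m)),
  [/\ row_free J, E *m A = J,
   (k + \rank (N *m B) = \rank A + \rank (N *m B *m N ^t*))%N,
   (forall H : 'M[C]_m, H \is hermsymmx -> H *m N ^t* = B *m N ^t* ->
    (ipos H + \rank (N *m B *m N ^t*)
      = ipos (N *m B *m N ^t*) + ipos (E *m H *m E ^t*) + \rank (N *m B))%N /\
    (ineg H + \rank (N *m B *m N ^t*)
      = ineg (N *m B *m N ^t*) + ineg (E *m H *m E ^t*) + \rank (N *m B))%N)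
   & forall Y, least_rank_sol A B Y <->
      Y \is hermsymmx /\ E *m (B - A *m Y *m A ^t*) *m E ^t* = 0].
Proof.
pose F := kermx (B *m N ^t*); pose J := row_base (F *m A).
have NA : N *m A = 0 by rewrite mulmx_ker.
have FB : F *m (B *m N ^t*) = 0 by rewrite mulmx_ker.
have [Phi hPhi] : exists Phi, J = Phi *m (F *m A).
  by apply/submxP; rewrite eq_row_base.
have hPsi : F *m A = col_base (F *m A) *m J by rewrite mulmx_base.
set Psi := col_base _ in hPsi.
pose E := Phi *m F.
(* The rows of F - Psi E are killed by A, hence lie in N and are orthogonal to
   F: replacing F by Psi E does not change the restriction of the form. *)
have red (H : 'M[C]_m) : H \is hermsymmx -> H *m N ^t* = B *m N ^t* ->
    F *m H *m F ^t* = Psi *m (E *m H *m E ^t*) *m Psi ^t*.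
  move=> hH HN.
  have /submxP[Th hTh] : (F - Psi *m E <= N)%MS.
    have e : Psi *m E *m A = F *m A.
      by rewrite -mulmxA /E -(mulmxA Phi) -hPhi -hPsi.
    apply/sub_kermxP.
    by rewrite mulmxBl e subrr.
  have NHF : N *m H *m F ^t* = 0 by rewrite herm_flip // -mulmxA HN FB ct0.
  have step : F *m H *m F ^t* = Psi *m E *m H *m F ^t*.
    apply/eqP; rewrite -subr_eq0 -!mulmxBl hTh -(mulmxA Th N H).
    by rewrite -(mulmxA Th) NHF mulmx0.
  have step2 : F *m H *m F ^t* = F *m H *m (Psi *m E) ^t*.
    by rewrite [RHS]herm_flip // -step -herm_flip.
  have -> : Psi *m (E *m H *m E ^t*) *m Psi ^t*
    = Psi *m Phi *m (F *m H *m (Psi *m E) ^t*).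
    by rewrite [(Psi *m E) ^t*]ctM {1}/E !mulmxA.
  by rewrite -step2 {1}step /E !mulmxA.
have NHE (H : 'M[C]_m) : H \is hermsymmx -> H *m N ^t* = B *m N ^t* -> N *m H = N *m B.
  move=> hH HN; rewrite -[LHS]trmxCK -[RHS]trmxCK [(N *m H) ^t*]ctM [(N *m B) ^t*]ctM.
  by rewrite (hermP _ hH) (hermP _ hB) HN.
have inertia (H : 'M[C]_m) : H \is hermsymmx -> H *m N ^t* = B *m N ^t* ->
    (ipos H + \rank (N *m B *m N ^t*)
      = ipos (N *m B *m N ^t*) + ipos (E *m H *m E ^t*) + \rank (N *m B))%N /\
    (ineg H + \rank (N *m B *m N ^t*)
      = ineg (N *m B *m N ^t*) + ineg (E *m H *m E ^t*) + \rank (N *m B))%N.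
  move=> hH HN; have hF := herm_congr F hH; have hE := herm_congr E hH.
  have e1 : E *m H *m E ^t* = Phi *m (F *m H *m F ^t*) *m Phi ^t*.
    by rewrite ctM /E !mulmxA.
  have e2 := red H hH HN.
  have := ipos_split N hH; have := ineg_split N hH.
  rewrite HN -/F NHE // => -> ->.
  by rewrite (ipos_congr2 hF hE e1 e2) (ineg_congr2 hF hE e1 e2).
exists (\rank (F *m A)), J, E; split=> //.
- exact: row_base_free.
- by rewrite hPhi mulmxA.
- (* The rows of F killed by A and the rows of N orthogonal to N are the same
     subspace; count its dimension in both ways. *)
  have := mxrank_mul_ker F A; have := mxrank_mul_ker N (B *m N ^t*).
  have -> : \rank (F :&: kermx A)%MS = \rank (N :&: kermx (B *m N ^t*))%MS.
    by rewrite capmxC.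
  rewrite mulmxA [X in _ -> _ = X -> _]mxrank_ker [X in _ = X -> _]mxrank_ker.
  have -> : \rank (B *m N ^t*) = \rank (N *m B).
    by rewrite -mxrank_ct ctM trmxCK (hermP _ hB).
  have := rank_leq_row A; have := rank_leq_col (N *m B).
  mxlia.
have hNY Y : (B - A *m Y *m A ^t*) *m N ^t* = B *m N ^t*.
  by rewrite mulmxBl -[A *m Y *m A ^t* *m _]mulmxA -ctM NA ct0 mulmx0 subr0.
have hHY Y : Y \is hermsymmx -> B - A *m Y *m A ^t* \is hermsymmx.
  by move=> hY; rewrite hermB ?herm_congr.
have rk Y : Y \is hermsymmx ->
  (\rank (B - A *m Y *m A ^t*)%R + \rank (N *m B *m N ^t*)
    = \rank (E *m (B - A *m Y *m A ^t*)%R *m E ^t*) + (\rank (N *m B)).*2)%N.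
  move=> hY; have hH := hHY Y hY; have [] := inertia _ hH (hNY Y).
  have := rank_inertia hH; have := rank_inertia (herm_congr E hH).
  have := rank_inertia (herm_congr N hB); mxlia.
move=> Y; split=> [[hY h]|[hY h]]; split=> //; last first.
  move=> Y' hY'; have := rk Y hY; have := rk Y' hY'; rewrite h mxrank0; mxlia.
(* The least rank is attained with a vanishing compression: use a right inverse
   of J. *)
have /row_freeP[R hR] := row_base_free (F *m A).
pose Y0 := R *m (E *m B *m E ^t*) *m R ^t*.
have hY0 : Y0 \is hermsymmx by rewrite !herm_congr.
have e0 : E *m (B - A *m Y0 *m A ^t*) *m E ^t* = 0.
  have EAR : E *m A *m R = 1%:M by rewrite /E -(mulmxA Phi) -hPhi.
  have -> : E *m (B - A *m Y0 *m A ^t*) *m E ^t*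
    = E *m B *m E ^t* - (E *m A *m R) *m (E *m B *m E ^t*) *m (E *m A *m R) ^t*.
    by rewrite mulmxBr mulmxBl ![(_ *m R) ^t*]ctM ![(_ *m A) ^t*]ctM !mulmxA.
  by rewrite EAR ct1 mul1mx mulmx1 subrr.
apply/eqP; rewrite -mxrank_eq0; have := h Y0 hY0.
have := rk Y hY; have := rk Y0 hY0; rewrite e0 mxrank0; mxlia.
Qed.

Lemma herm_mxM : mxM A B \is hermsymmx.
Proof. exact: herm_border. Qed.

Lemma mxNE : mxN A B
  = block_mx B (row_mx (B *m A) A) ((row_mx (B *m A) A) ^t*) 0.
Proof. by rewrite /mxN ct_row ctM (hermP _ hB). Qed.

Lemma herm_mxN : mxN A B \is hermsymmx.
Proof. by rewrite mxNE herm_border. Qed.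

Lemma ipos_mxM : ipos (mxM A B) = (\rank A + ipos (N *m B *m N ^t*))%N.
Proof. exact: ipos_border. Qed.

Lemma ineg_mxM : ineg (mxM A B) = (\rank A + ineg (N *m B *m N ^t*))%N.
Proof. exact: ineg_border. Qed.

Lemma rank_ABA :
  \rank (row_mx A (B *m A)) = (\rank A + \rank (N *m B *m A))%N.
Proof. by rewrite rank_row_kermx mulmxA. Qed.

Lemma ipos_mxN : ipos (mxN A B)
  = (\rank (row_mx A (B *m A)) + ipos (L *m B *m L ^t*))%N.
Proof. by rewrite mxNE ipos_border // rank_row_mxC. Qed.

Lemma ineg_mxN : ineg (mxN A B)
  = (\rank (row_mx A (B *m A)) + ineg (L *m B *m L ^t*))%N.
Proof. by rewrite mxNE ineg_border // rank_row_mxC. Qed.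

Lemma kermx_BA_A : L *m A = 0 /\ L *m (B *m A) = 0.
Proof.
have := mulmx_ker (row_mx (B *m A) A).
by rewrite mul_mx_row -row_mx0 => /eq_row_mx[].
Qed.

(** The rows killed by A are the orthogonal complement of the row space of
    [A^*]. *)
Lemma row_full_kermx_ct : row_full (col_mx N (A ^t*)).
Proof.
rewrite /row_full -addsmxE mxrank_disjoint_sum.
  by rewrite mxrank_ker mxrank_ct subnK // rank_leq_row.
by apply: orthomx_disj; apply/orthomx1P; rewrite trmxCK mulmx_ker.
Qed.

(** Both sides are reduced to the form B on the rows killed by A, bordered by [B
    A]. On the side of [mxN] this is a double use of [ipos_border], which
    describes the rows killed by [B A] and A together in one step or in two. On
    the side of H it is the matrix of H in the generators [N] and [A^*], whose
    last block vanishes by the normal equation. *)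
Lemma inertia_mxN_residual (H : 'M[C]_m) : H \is hermsymmx ->
  N *m H = N *m B -> A ^t* *m H *m A = 0 ->
  ipos (mxN A B) = (\rank A + ipos H)%N /\ ineg (mxN A B) = (\rank A + ineg H)%N.
Proof.
move=> hH NH AHA; have hNBN := herm_congr N hB.
pose L' := kermx (N *m B *m A); have [LA LBA] := kermx_BA_A.
(* L and L' N have the same row space. *)
have /submxP[X hX] : (L <= N)%MS by apply/sub_kermxP.
have /submxP[Y hY] : (X <= L')%MS.
  by apply/sub_kermxP; rewrite -mulmxA mulmxA -hX.
have /submxP[W hW] : (L' *m N <= L)%MS.
  have NA : N *m A = 0 := mulmx_ker A.
  have NBA : L' *m (N *m B *m A) = 0 := mulmx_ker _.
  apply/sub_kermxP; rewrite mul_mx_row -(mulmxA L' N A) NA mulmx0.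
  by rewrite -(mulmxA L' N) (mulmxA N) NBA row_mx0.
have e1 : L *m B *m L ^t* = Y *m (L' *m (N *m B *m N ^t*) *m L' ^t*) *m Y ^t*.
  have -> : L = Y *m L' *m N by rewrite -hY.
  by rewrite !congrM.
have e2 : L' *m (N *m B *m N ^t*) *m L' ^t* = W *m (L *m B *m L ^t*) *m W ^t*.
  by rewrite -!congrM -hW.
have h1 := herm_congr L hB; have h2 := herm_congr L' hNBN.
rewrite ipos_mxN ineg_mxN (ipos_congr2 h2 h1 e1 e2) (ineg_congr2 h2 h1 e1 e2).
have /row_fullP[G hG] := row_full_kermx_ct.
rewrite -(ipos_congr hH hG) -(ineg_congr hH hG) rank_ABA -!addnA.
rewrite -(ipos_border (N *m B *m A) hNBN) -(ineg_border (N *m B *m A) hNBN).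
have -> : col_mx N (A ^t*) *m H *m (col_mx N (A ^t*)) ^t*
  = block_mx (N *m B *m N ^t*) (N *m B *m A) ((N *m B *m A) ^t*) 0; last by [].
rewrite ct_col trmxCK mul_col_mx mul_col_row NH AHA; congr block_mx.
by rewrite -[N *m B]NH -[A in RHS]trmxCK -herm_flip.
Qed.

(** For semidefinite B every restriction has no negative part and [N B] has the
    rank of [N B N^*]. The last bound holds because the rows that are killed by
    both A and [B A] map under B into the part of the row space of [N B] that A
    kills. *)
Lemma psd_inertia : psdmx B ->
  [/\ \rank (mxM A B) = (\rank A + \rank (row_mx A B))%N, ineg (mxM A B) = \rank A,
   ineg (mxN A B) = \rank (row_mx A (B *m A)) & (ipos (mxN A B) <= ipos (mxM A B))%N].
Proof.
move=> /psdmxP[_ B0].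
have c0 p (P : 'M[C]_(p, m)) : ineg (P *m B *m P ^t*) = 0%N.
  by apply/eqP; rewrite -leqn0 -B0 ineg_congr_le.
have rNB : \rank (N *m B) = \rank (N *m B *m N ^t*).
  have [U hU] := gram_of_ineg0 hB B0.
  apply/eqP; rewrite eqn_leq mxrankM_maxl andbT.
  have -> : N *m B *m N ^t* = (N *m U ^t*) *m (N *m U ^t*) ^t*.
    by rewrite {1}hU [(N *m U ^t*) ^t*]ctM trmxCK !mulmxA.
  by rewrite mxrank_ctM {1}hU mulmxA mxrankM_maxl.
have hM := rank_inertia herm_mxM.
have hN := rank_inertia (herm_congr N hB).
rewrite ineg_mxM ineg_mxN !c0 !addn0; split=> //.
  by rewrite hM ipos_mxM ineg_mxM rank_row_kermx -/N rNB hN c0; mxlia.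
rewrite ipos_mxN ipos_mxM rank_ABA -addnA leq_add2l.
have := rank_inertia (herm_congr L hB); have := mxrankM_maxl (L *m B) (L ^t*).
have [LA LBA] := kermx_BA_A.
have : (\rank (L *m B) <= \rank (N *m B :&: kermx A)%MS)%N.
  apply: mxrankS; rewrite sub_capmx; apply/andP; split.
    by apply: submxMr; apply/sub_kermxP.
  by apply/sub_kermxP; rewrite -mulmxA.
have := mxrank_mul_ker (N *m B) A; move: hN; rewrite rNB !c0; mxlia.
Qed.

(** * The differences of solutions *)

(** Both solution sets are affine: X is a least-squares solution when [A X A^*]
    has a prescribed value, Y is a least-rank solution when [J Y J^*] has one,
    where [J = E A]. So [X - Y] is subject to the single condition that [J (X -
    Y) J^*] be the difference K of the prescribed values, namely minus the
    compression by E of the least-squares residual. The remaining clauses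
    translate k and the inertia of K into ranks and inertias of [mxM] and [mxN]. *)
Lemma difference_set :
  exists k (J : 'M[C]_(k, n)) (K : 'M[C]_k),
  [/\ [/\ row_free J, K \is hermsymmx & (k + \rank (row_mx A B) = \rank (mxM A B))%N],
   (ipos (mxN A B) + k = \rank A + ipos (mxM A B) + ineg K)%N,
   (ineg (mxN A B) + k = \rank A + ineg (mxM A B) + ipos K)%N,
   (forall X Y, least_squares_sol A B X -> least_rank_sol A B Y ->
      X - Y \is hermsymmx /\ J *m (X - Y) *m J ^t* = K)
   & (forall Z, Z \is hermsymmx -> J *m Z *m J ^t* = K ->
      exists X Y, [/\ least_squares_sol A B X, least_rank_sol A B Y & X - Y = Z])].
Proof.
have [k [J [E [fJ EA hk inertia hT]]]] := least_rank_reduction.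
have [X0 hX0 eX0] := normal_sol_exists A hB.
pose H := B - A *m X0 *m A ^t*.
have hH : H \is hermsymmx by rewrite hermB ?herm_congr.
have NA : N *m A = 0 by rewrite mulmx_ker.
have HN : H *m N ^t* = B *m N ^t*.
  by rewrite mulmxBl -[A *m X0 *m A ^t* *m _]mulmxA -ctM NA ct0 mulmx0 subr0.
have NH : N *m H = N *m B.
  by rewrite mulmxBr !mulmxA NA !mul0mx subr0.
have [pN nN] := inertia_mxN_residual hH NH eX0.
have [pH nH] := inertia H hH HN.
have hEHE := herm_congr E hH.
have EXE X : E *m (A *m X *m A ^t*) *m E ^t* = J *m X *m J ^t*.
  by rewrite -EA congrM.
have rM := rank_inertia herm_mxM; have rN := rank_inertia (herm_congr N hB).
exists k, J, (- (E *m H *m E ^t*)); split.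
- rewrite hermN //; split=> //.
  by move: hk rM rN; rewrite ipos_mxM ineg_mxM rank_row_kermx -/N; mxlia.
- by move: hk pN pH rM rN; rewrite ipos_mxM inegN // -/N; mxlia.
- by move: hk nN nH rM rN; rewrite ineg_mxM -ineg_ipos // -/N; mxlia.
- move=> X Y /least_squaresP-/(_ hB)[hX eX] /hT[hY eY]; split; first exact: hermB.
  have := normal_sol_unique eX eX0 => eXX.
  move: eY; rewrite mulmxBr mulmxBl EXE => /eqP; rewrite subr_eq0 => /eqP eY.
  rewrite mulmxBr mulmxBl -eY -[J *m X *m _]EXE eXX /H.
  by rewrite mulmxBr mulmxBl opprB.
move=> Z hZ eZ; exists X0, (X0 - Z); split; last by rewrite opprB addrC subrK.
  by apply/least_squaresP.
apply/hT; split; first exact: hermB.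
have -> : B - A *m (X0 - Z) *m A ^t* = H + A *m Z *m A ^t*.
  by rewrite mulmxBr mulmxBl opprB addrCA addrC.
by rewrite mulmxDr mulmxDl EXE eZ subrr.
Qed.

End Pencil.

(** * Extremal values *)

Section Pairs.
Variables (n : nat) (S T : 'M[C]_n -> Prop) (P : 'M[C]_n -> 'M[C]_n -> Prop).
Variables (f : 'M[C]_n -> nat) (z : int).

Lemma exists_pair_max b :
  (forall X Y, S X -> T Y -> (P X Y <-> f (X - Y) = b) /\ (f (X - Y) <= b)%N) ->
  max_diff_eq S T f z -> (exists_pair S T P <-> z = b%:Z).
Proof.
move=> h [[X [Y [SX TY <-]]] hz]; split=> [[X' [Y' [SX' TY' /(h _ _ SX' TY').1 e]]]|e].
  by have := hz _ _ SX' TY'; rewrite e; have := (h _ _ SX TY).2; lia.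
by exists X, Y; split=> //; apply/(h _ _ SX TY).1; lia.
Qed.

Lemma forall_pair_min b :
  (forall X Y, S X -> T Y -> (P X Y <-> f (X - Y) = b) /\ (f (X - Y) <= b)%N) ->
  min_diff_eq S T f z -> (forall_pair S T P <-> z = b%:Z).
Proof.
move=> h [[X [Y [SX TY <-]]] hz]; split=> [/(_ X Y SX TY) /(h _ _ SX TY).1 -> //|e].
move=> X' Y' SX' TY'; apply/(h _ _ SX' TY').1.
by have := hz _ _ SX' TY'; have := (h _ _ SX' TY').2; lia.
Qed.

Lemma exists_pair_min :
  (forall X Y, S X -> T Y -> (P X Y <-> f (X - Y) = 0%N)) ->
  min_diff_eq S T f z -> (exists_pair S T P <-> z = 0).
Proof.
move=> h [[X [Y [SX TY <-]]] hz]; split=> [[X' [Y' [SX' TY' /(h _ _ SX' TY') e]]]|e].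
  by have := hz _ _ SX' TY'; rewrite e; lia.
by exists X, Y; split=> //; apply/(h _ _ SX TY); lia.
Qed.

Lemma forall_pair_max :
  (forall X Y, S X -> T Y -> (P X Y <-> f (X - Y) = 0%N)) ->
  max_diff_eq S T f z -> (forall_pair S T P <-> z = 0).
Proof.
move=> h [[X [Y [SX TY <-]]] hz]; split=> [/(_ X Y SX TY) /(h _ _ SX TY) -> //|e].
move=> X' Y' SX' TY'; apply/(h _ _ SX' TY').
by have := hz _ _ SX' TY'; lia.
Qed.

End Pairs.

Section Values.
Variables (k n : nat) (J : 'M[C]_(k, n)) (K : 'M[C]_k) (S T : 'M[C]_n -> Prop).
Hypotheses (fJ : row_free J) (hK : K \is hermsymmx).
Hypothesis sub : forall X Y, S X -> T Y ->
  X - Y \is hermsymmx /\ J *m (X - Y) *m J ^t* = K.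
Hypothesis sup : forall Z, Z \is hermsymmx -> J *m Z *m J ^t* = K ->
  exists X Y, [/\ S X, T Y & X - Y = Z].

Lemma extremal_values :
  [/\ [/\ max_diff_eq S T (fun D => \rank D) (minn n (\rank K + (n - k).*2))%:Z,
      max_diff_eq S T (@ipos C n) (ipos K + (n - k))%:Z
    & max_diff_eq S T (@ineg C n) (ineg K + (n - k))%:Z],
    min_diff_eq S T (fun D => \rank D) (\rank K)%:Z,
    min_diff_eq S T (@ipos C n) (ipos K)%:Z
  & min_diff_eq S T (@ineg C n) (ineg K)%:Z].
Proof.
have up (f : 'M[C]_n -> nat) z :
    (exists Z, [/\ Z \is hermsymmx, J *m Z *m J ^t* = K & f Z = z]) ->
    (forall Z, Z \is hermsymmx -> J *m Z *m J ^t* = K -> (f Z <= z)%N) ->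
  max_diff_eq S T f z%:Z.
  move=> [Z [hZ eZ <-]] h; split.
    by have [X [Y [SX TY e]]] := sup hZ eZ; exists X, Y; rewrite e.
  by move=> X Y SX TY; have [h1 h2] := sub SX TY; have := h _ h1 h2; lia.
have dn (f : 'M[C]_n -> nat) z :
    (exists Z, [/\ Z \is hermsymmx, J *m Z *m J ^t* = K & f Z = z]) ->
    (forall Z, Z \is hermsymmx -> J *m Z *m J ^t* = K -> (z <= f Z)%N) ->
  min_diff_eq S T f z%:Z.
  move=> [Z [hZ eZ <-]] h; split.
    by have [X [Y [SX TY e]]] := sup hZ eZ; exists X, Y; rewrite e.
  by move=> X Y SX TY; have [h1 h2] := sub SX TY; have := h _ h1 h2; lia.
have [Zm [hm em pm nm]] := fiber_min fJ hK.
split; first split.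
- apply: up; first by have [Z [? ? ?]] := fiber_max_rank fJ hK; exists Z.
  move=> Z hZ eZ; have := fiber_ipos_le fJ hZ eZ; have := fiber_ineg_le fJ hZ eZ.
  have := rank_inertia hZ; have := rank_inertia hK; have := rank_leq_row Z; mxlia.
- by apply: up; [apply: fiber_max_ipos | move=> Z; apply: fiber_ipos_le].
- by apply: up; [apply: fiber_max_ineg | move=> Z; apply: fiber_ineg_le].
- apply: dn; first by exists Zm; rewrite !rank_inertia // pm nm.
  by move=> Z _ <-; apply: leq_trans (mxrankM_maxl _ _) (mxrankM_maxr _ _).
- by apply: dn; [exists Zm | move=> Z hZ <-; apply: ipos_congr_le].
- by apply: dn; [exists Zm | move=> Z hZ <-; apply: ineg_congr_le].
Qed.

End Values.

(** Adjoining the columns of K leaves the rank of L unchanged when they already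
    lie in its range. *)
Lemma range_subE m p q (K : 'M[C]_(m, p)) (L : 'M[C]_(m, q)) :
  range_sub K L = (\rank (row_mx L K) == \rank L).
Proof.
rewrite /range_sub -[\rank (row_mx _ _)]mxrank_tr -(mxrank_tr L) tr_row_mx -addsmxE.
have [_ e] := mxrank_leqif_eq (addsmxSl L^T K^T); rewrite eq_sym e addsmxSl /=.
by rewrite addsmx_sub submx_refl.
Qed.

End HermitianMatrices.

Theorem theorem6p2 (R : realType) (m n : nat)
    (A : 'M[complex R]_(m, n)) (B : 'M[complex R]_m) (hB : B \is hermsymmx) :
  let S := least_squares_sol A B in
  let T := least_rank_sol A B in
  let M := mxM A B in
  let N := mxN A B in
  let rk (p q : nat) (K : 'M[complex R]_(p, q)) : int := (\rank K)%:Z in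
  let ip (p : nat) (K : 'M[complex R]_p) : int := (ipos K)%:Z in
  let im (p : nat) (K : 'M[complex R]_p) : int := (ineg K)%:Z in
  let rA := rk _ _ A in
  let rAB := rk _ _ (row_mx A B) in
  let rABA := rk _ _ (row_mx A (B *m A)) in
  let rM := rk _ _ M in
  let rN := rk _ _ N in
  let nz : int := n%:Z in
  (* extremal ranks and inertias of X - Y *)
  (max_diff_eq S T (fun D => \rank D)
       (Num.min nz (2 * nz + rN - 2 * rA - rM)) /\
   min_diff_eq S T (fun D => \rank D) (rN + rM - 2 * rAB - 2 * rA) /\
   max_diff_eq S T (@ipos _ n) (im _ N + nz - rA - im _ M) /\
   max_diff_eq S T (@ineg _ n) (ip _ N + nz - rA - ip _ M) /\
   min_diff_eq S T (@ipos _ n) (im _ N + ip _ M - rAB - rA) /\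
   min_diff_eq S T (@ineg _ n) (ip _ N + im _ M - rAB - rA)) /\
  (psdmx B ->
   max_diff_eq S T (fun D => \rank D)
       (Num.min nz (2 * nz + rABA - 3 * rA)) /\
   min_diff_eq S T (fun D => \rank D) (rABA - rA) /\
   max_diff_eq S T (@ipos _ n) (rABA + nz - 2 * rA) /\
   max_diff_eq S T (@ineg _ n) (nz - rA) /\
   min_diff_eq S T (@ipos _ n) (rABA - rA) /\
   min_diff_eq S T (@ineg _ n) 0) /\
  (* consequences for arbitrary Hermitian B *)
  ((exists_pair S T (fun X Y => X - Y \in unitmx) <-> rN >= 2 * rA + rM - nz) /\
   (forall_pair S T (fun X Y => X - Y \in unitmx) <->
      rN + rM = 2 * rAB + 2 * rA + nz) /\
   (exists_pair S T (fun X Y => X = Y) <-> rN + rM = 2 * rAB + 2 * rA) /\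
   (exists_pair S T (fun X Y => loewner_gt X Y) <-> im _ N = im _ M + rA) /\
   (forall_pair S T (fun X Y => loewner_gt X Y) <->
      im _ N = rA + rAB - ip _ M + nz) /\
   (exists_pair S T (fun X Y => loewner_ge X Y) <->
      ip _ N = rA + rAB - im _ M) /\
   (forall_pair S T (fun X Y => loewner_ge X Y) <->
      ip _ N = ip _ M + rA - nz) /\
   (exists_pair S T (fun X Y => loewner_gt Y X) <-> ip _ N = ip _ M + rA) /\
   (forall_pair S T (fun X Y => loewner_gt Y X) <->
      ip _ N = rA + rAB - im _ M + nz) /\
   (exists_pair S T (fun X Y => loewner_ge Y X) <->
      im _ N = rA + rAB - ip _ M) /\
   (forall_pair S T (fun X Y => loewner_ge Y X) <->
      im _ N = im _ M + rA - nz)) /\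
  (* consequences for positive semidefinite B *)
  (psdmx B ->
   (exists_pair S T (fun X Y => X - Y \in unitmx) <-> rABA >= 3 * rA - nz) /\
   (forall_pair S T (fun X Y => X - Y \in unitmx) <-> rABA = rA + nz) /\
   (exists_pair S T (fun X Y => X = Y) <-> range_sub (B *m A) A) /\
   (exists_pair S T (fun X Y => loewner_gt X Y) <-> rABA = 2 * rA) /\
   (forall_pair S T (fun X Y => loewner_gt X Y) <-> rABA = rA + nz) /\
   exists_pair S T (fun X Y => loewner_ge X Y) /\
   (forall_pair S T (fun X Y => loewner_ge X Y) <-> rA = nz) /\
   (exists_pair S T (fun X Y => loewner_gt Y X) <-> A = 0) /\
   (exists_pair S T (fun X Y => loewner_ge Y X) <-> range_sub (B *m A) A) /\
   (forall_pair S T (fun X Y => loewner_ge Y X) <-> rABA = 2 * rA - nz)).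
Proof.
move=> S T M N rk ip im rA rAB rABA rM rN nz.
have [k [J [K [[fJ hK ek] ep en sub sup]]]] := difference_set A hB.
have [[Maxr Maxp Maxn] Minr Minp Minn] := extremal_values fJ hK sub sup.
rewrite -/S -/T in Maxr Maxp Maxn Minr Minp Minn sub.
have rkK := rank_inertia hK.
have rkM := rank_inertia (herm_mxM A hB); have rkN := rank_inertia (herm_mxN A hB).
have kn : (k <= n)%N by rewrite -(eqP fJ) rank_leq_col.
have psd := psd_inertia A hB.
(* Naming the integers of the statement turns each claim into linear arithmetic
   over the relations between them that are established next. *)
pose q : int := (ineg K)%:Z; pose p : int := (ipos K)%:Z.
pose ipM : int := ip _ M; pose imM : int := im _ M.
pose ipN : int := ip _ N; pose imN : int := im _ N.
have eM : rM = k%:Z + rAB by rewrite /rM /rk -/M -ek addnC PoszD addrC.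
have eip : ipN + k%:Z = rA + ipM + q by rewrite /ipN /ipM /ip /rA /rk /q -!PoszD ep.
have ein : imN + k%:Z = rA + imM + p by rewrite /imN /imM /im /rA /rk /p -!PoszD en.
have eN2 : rN = ipN + imN by rewrite /rN /rk rkN PoszD.
have eM2 : rM = ipM + imM by rewrite /rM /rk rkM PoszD.
have epsd : psdmx B -> [/\ rM = rA + rAB, imM = rA, imN = rABA & ipN <= ipM].
  by move=> /psd[h1 h2 h3 h4]; rewrite /rM /imM /imN /ipN /ipM /im /ip /rk h1 h2 h3.
have A0 : A = 0 <-> rA = 0.
  by rewrite /rA /rk; split=> [->|[/eqP]]; rewrite ?mxrank0 // mxrank_eq0 => /eqP.
have rng : range_sub (B *m A) A <-> rABA = rA.
  by rewrite range_subE /rABA /rA /rk; split=> [/eqP ->|[->]].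
rewrite -/ipM -/imM -/ipN -/imN.
have p0 : 0 <= p by []. have q0 : 0 <= q by [].
have knz : k%:Z <= nz by rewrite /nz; lia.
have hr X Y : S X -> T Y ->
    (X - Y \in unitmx <-> \rank (X - Y) = n) /\ (\rank (X - Y)%R <= n)%N.
  by move=> _ _; rewrite -row_free_unit rank_leq_row; split=> //; split=> /eqP.
have hr0 X Y : S X -> T Y -> (X = Y <-> \rank (X - Y) = 0%N).
  move=> _ _; split=> [->|/eqP]; first by rewrite subrr mxrank0.
  by rewrite mxrank_eq0 subr_eq0 => /eqP.
have hgt X Y : S X -> T Y ->
    (loewner_gt X Y <-> ipos (X - Y) = n) /\ (ipos (X - Y)%R <= n)%N.
  move=> SX TY; have [hD _] := sub X Y SX TY; split.
    by rewrite /loewner_gt pdmxP; tauto.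
  by have := rank_inertia hD; have := rank_leq_row (X - Y); mxlia.
have hlt X Y : S X -> T Y ->
    (loewner_gt Y X <-> ineg (X - Y) = n) /\ (ineg (X - Y)%R <= n)%N.
  move=> SX TY; have [hD _] := sub X Y SX TY; split.
    by rewrite /loewner_gt pdmxP -opprB -ineg_ipos //; have := hermN hD; tauto.
  by have := rank_inertia hD; have := rank_leq_row (X - Y); mxlia.
have hge X Y : S X -> T Y -> (loewner_ge X Y <-> ineg (X - Y) = 0%N).
  by move=> SX TY; have [hD _] := sub X Y SX TY; rewrite /loewner_ge psdmxP; tauto.
have hle X Y : S X -> T Y -> (loewner_ge Y X <-> ipos (X - Y) = 0%N).
  move=> SX TY; have [hD _] := sub X Y SX TY.
  by rewrite /loewner_ge psdmxP -opprB inegN //; have := hermN hD; tauto.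
have erK : (\rank K)%:Z = p + q by rewrite rkK PoszD.
have {}Maxr : max_diff_eq S T (fun D => \rank D) (Num.min nz (p + q + 2 * (nz - k%:Z))).
  suff <- : (minn n (\rank K + (n - k).*2))%:Z
    = Num.min nz (p + q + 2 * (nz - k%:Z)) by [].
  by rewrite /nz; lia.
have {}Maxp : max_diff_eq S T (@ipos _ n) (p + (nz - k%:Z)).
  by have <- : (ipos K + (n - k))%:Z = p + (nz - k%:Z) by rewrite /nz /p; lia.
have {}Maxn : max_diff_eq S T (@ineg _ n) (q + (nz - k%:Z)).
  by have <- : (ineg K + (n - k))%:Z = q + (nz - k%:Z) by rewrite /nz /q; lia.
rewrite erK -/p -/q in Minr Minp Minn.
have ex_unit := exists_pair_max hr Maxr.
have all_unit := forall_pair_min hr Minr.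
have ex_eq := exists_pair_min hr0 Minr.
have ex_gt := exists_pair_max hgt Maxp.
have all_gt := forall_pair_min hgt Minp.
have ex_ge := exists_pair_min hge Minn.
have all_ge := forall_pair_max hge Maxn.
have ex_lt := exists_pair_max hlt Maxn.
have all_lt := forall_pair_min hlt Minn.
have ex_le := exists_pair_min hle Minp.
have all_le := forall_pair_max hle Maxp.
rewrite -/nz in ex_unit all_unit ex_gt all_gt ex_lt all_lt.
clearbody ipM imM ipN imN rM rN rA rAB rABA p q.
have keqM f x y : max_diff_eq S T f x -> x = y -> max_diff_eq S T f y by move=> h <-.
have keqm f x y : min_diff_eq S T f x -> x = y -> min_diff_eq S T f y by move=> h <-.
split.
  refine (conj (keqM _ _ _ Maxr _) (conj (keqm _ _ _ Minr _) (conj (keqM _ _ _ Maxp _)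
    (conj (keqM _ _ _ Maxn _) (conj (keqm _ _ _ Minp _) (keqm _ _ _ Minn _)))))); lia.
split.
  move=> /epsd[h1 h2 h3 h4].
  refine (conj (keqM _ _ _ Maxr _) (conj (keqm _ _ _ Minr _) (conj (keqM _ _ _ Maxp _)
    (conj (keqM _ _ _ Maxn _) (conj (keqm _ _ _ Minp _) (keqm _ _ _ Minn _)))))); lia.
split.
  refine (conj (iff_trans ex_unit _) (conj (iff_trans all_unit _)
    (conj (iff_trans ex_eq _) (conj (iff_trans ex_gt _) (conj (iff_trans all_gt _)
    (conj (iff_trans ex_ge _) (conj (iff_trans all_ge _) (conj (iff_trans ex_lt _)
    (conj (iff_trans all_lt _) (conj (iff_trans ex_le _)
    (iff_trans all_le _))))))))))); lia.
move=> /epsd[h1 h2 h3 h4].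
refine (conj (iff_trans ex_unit _) (conj (iff_trans all_unit _)
    (conj (iff_trans ex_eq (iff_trans _ (iff_sym rng)))
    (conj (iff_trans ex_gt _) (conj (iff_trans all_gt _)
    (conj (ex_ge.2 _) (conj (iff_trans all_ge _)
    (conj (iff_trans ex_lt (iff_trans _ (iff_sym A0)))
    (conj (iff_trans ex_le (iff_trans _ (iff_sym rng)))
    (iff_trans all_le _)))))))))); lia.
Qed.
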